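(* Let $Q\subset\mathbb R^D$ be a bounded domain and let $\mathbf U_n:Q\to\mathbb R^m$, $n=1,2,\dots$, be an equi-integrable sequence of $L^1$ functions. Then there are a subsequence $\{\mathbf U_{n_j}\}_{j=1}^\infty$ and a parametrized family of probability measures $\{\mathcal V_y\}_{y\in Q}\subset\mathfrak P(\mathbb R^m)$ such that $\{\mathbf U_{n_j}\}_{j=1}^\infty$ is completely S-convergent to $\mathcal V$.
   Context: $D,m$ are positive integers, and $\mathfrak P(\mathbb R^m)$ is the set of Borel probability measures on $\mathbb R^m$. A **regular summation method** is an infinite matrix $\{s_{n,N}\}_{n,N\ge1}$ with $0\le s_{n,N}\le\overline s$ for a constant $\overline s$ independent of $n,N$; $s_{n,N}=0$ for $n>N$; and $\sum_{n=1}^Ns_{n,N}=N$ for every $N\ge1$. Measurable functions $\mathbf U_n:Q\to\mathbb R^m$ are **S-convergent** to a family $\{\mathcal V_y\}_{y\in Q}$, $\mathcal V_y\in\mathfrak P(\mathbb R^m)$ for a.a. $y$, with respect to $\{s_{n,N}\}$ if $$\int_Qw\Big[\frac1N\sum_{n=1}^Ns_{n,N}\delta_{\mathbf U_n(y)};\mathcal V_y\Big]dy\to0\quad\text{as }N\to\infty,$$ where $w$ is the 1-Wasserstein distance and $\delta$ the Dirac mass. The sequence is **completely S-convergent** to $\mathcal V$ if this convergence holds for every regular summation method and every subsequence $\{\mathbf U_{n_j}\}_{j=1}^\infty$ of the original sequence (the subsequence re-indexed by $j$). *)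

(* Defs.v *)
From HB Require Import structures.
From mathcomp Require Import all_boot all_order all_algebra.
From mathcomp Require Import all_classical all_reals all_analysis.
From mathcomp Require Import measurable_realfun.

Set Implicit Arguments.
Unset Strict Implicit.
Unset Printing Implicit Defensive.

Import Order.TTheory GRing.Theory Num.Theory.
Import numFieldNormedType.Exports.

Local Open Scope classical_set_scope.
Local Open Scope ring_scope.

(* The library norm on matrices is the sup norm; it has the same open sets and
   bounded sets as the Euclidean norm, which is the one measuring distances
   and integrating vector-valued functions below. *)
Definition enorm (R : realType) (m : nat) (x : 'rV[R]_m) : R :=
  Num.sqrt (\sum_(i < m) x ord0 i ^+ 2).

Fact matrix_borel_display : measure_display.
Proof. exact: default_measure_display. Qed.

(* Matrices are measured by the Borel sigma-algebra of their topology. *)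
HB.instance Definition _ (R : realType) (m n : nat) :=
  @isMeasurable.Build matrix_borel_display 'M[R]_(m, n)
    <<s @open 'M[R]_(m, n) >> (@sigma_algebra0 _ setT _)
    (@sigma_algebraC _ _) (@sigma_algebra_bigcup _ setT _).

(* Lebesgue measure on R^D for D > 0: the Caratheodory restriction of the outer
   measure A |-> inf sum_k vol(B_k) over sequences of boxes B_k covering A.
   For D = 0 the empty set would have no cover of zero volume. *)
Section lebesgue.
Context (R : realType) (D : nat).

Definition box (ab : 'rV[R]_D.+1 * 'rV[R]_D.+1) : set 'rV[R]_D.+1 :=
  [set x | forall i, ab.1 ord0 i < x ord0 i < ab.2 ord0 i].

Definition box_volume (ab : 'rV[R]_D.+1 * 'rV[R]_D.+1) : R :=
  \prod_(i < D.+1) Num.max 0 (ab.2 ord0 i - ab.1 ord0 i).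

Definition lebesgue_outer (A : set 'rV[R]_D.+1) : \bar R :=
  ereal_inf [set (\sum_(k <oo) (box_volume (B k))%:E)%E
            | B in [set B : nat -> 'rV[R]_D.+1 * 'rV[R]_D.+1
                   | A `<=` \bigcup_k box (B k)]].

Local Open Scope ereal_scope.

Let vol_ge0 ab : 0 <= (box_volume ab)%:E.
Proof. by rewrite lee_fin; apply: prodr_ge0 => i _; rewrite le_max lexx. Qed.

Let vol0 : box_volume (0%R, 0%R) = 0%R.
Proof. by rewrite /box_volume big_ord_recl /= !mxE subrr maxxx mul0r. Qed.

Let lebesgue_outer_ge0 A : 0 <= lebesgue_outer A.
Proof.
by apply: le_ereal_inf_tmp => _ [B _ <-]; apply: nneseries_ge0 => k *.
Qed.

Let lebesgue_outer0 : lebesgue_outer set0 = 0.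
Proof.
apply/eqP; rewrite eq_le lebesgue_outer_ge0 andbT.
apply: ereal_inf_lbound; exists (fun=> (0%R, 0%R)); first exact: sub0set.
by rewrite eseries0// => k *; rewrite vol0.
Qed.

Let le_lebesgue_outer : {homo lebesgue_outer : A B / A `<=` B >-> A <= B}.
Proof.
move=> A B AB; apply/ereal_inf_le_tmp => _ [F BF <-].
by exists F => //; exact: subset_trans BF.
Qed.

Let lebesgue_outer_sigma_subadditive : sigma_subadditive lebesgue_outer.
Proof.
move=> A; have [[i ioo]|] := pselect (exists i, lebesgue_outer (A i) = +oo).
  rewrite (eseries_pinfty _ _ ioo) ?leey// => n _.
  by rewrite -ltNye (lt_le_trans _ (lebesgue_outer_ge0 _)).
rewrite -forallNE => Aoo.
suff add2e (e : {posnum R}) : lebesgue_outer (\bigcup_n A n) <=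
    \sum_(i <oo) lebesgue_outer (A i) + e%:num%:E.
  by apply/lee_addgt0Pr => _/posnumP[].
rewrite (le_trans _ (epsilon_trick _ _ _))//.
pose mu ab := (box_volume ab)%:E.
pose P n (B : nat -> 'rV[R]_D.+1 * 'rV[R]_D.+1) :=
  A n `<=` \bigcup_k box (B k) /\
  \sum_(k <oo) mu (B k) <= lebesgue_outer (A n) + (e%:num / (2 ^ n.+1)%:R)%:E.
have [G PG] : {G & forall n, P n (G n)}.
  apply: (@choice _ _ P) => n; rewrite /P /lebesgue_outer.
  set S := (X in ereal_inf X); move infS : (ereal_inf S) => iS.
  case: iS infS => [r Sr|Soo|Soo].
  - have en1 : (0 < e%:num / (2 ^ n.+1)%:R)%R by [].
    have /(lb_ereal_inf_adherent en1) : ereal_inf S \is a fin_num by rewrite Sr.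
    move=> [x [B AnB muBx] xS].
    by exists B; split => //; rewrite /mu muBx -Sr; exact/ltW.
  - by have := Aoo n; rewrite /lebesgue_outer Soo.
  - suff : lbound S 0 by move/le_ereal_inf_tmp; rewrite Soo.
    by move=> /= _ [B AnB] <-; exact: nneseries_ge0.
have muG_ge0 x : 0 <= (mu \o uncurry G) x by exact: vol_ge0.
apply: (@le_trans _ _ (\esum_(i in setT) (mu \o uncurry G) i)).
  apply: ereal_inf_lbound => /=.
  have /card_esym/ppcard_eqP[f] := card_nat2.
  exists (uncurry G \o f).
    apply: (@subset_trans _  (\bigcup_n \bigcup_k box (G n k))) => [t [i _]|].
      by move=> /(PG i).1 -[j _ ?]; exists i => //; exists j.
    move=> t [i _ [j _ Bijt]]; exists (f^-1%FUN (i, j)) => //=.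
    by rewrite invK ?inE.
  rewrite -[LHS]/(\sum_(k <oo) ((mu \o uncurry G) \o f) k).
  rewrite -(esum_pred_image (mu \o uncurry G) _ xpredT) ?[fun=> _]set_true//.
  by rewrite image_eq.
rewrite (_ : esum _ _ = \sum_(i <oo) \sum_(j <oo ) mu (G i j)); last first.
  pose J : nat -> set (nat * nat) := fun i => [set (i, j) | j in setT].
  rewrite (_ : setT = \bigcup_k J k); last first.
    by rewrite predeqE => -[a b]; split => // _; exists a => //; exists b.
  rewrite esum_bigcupT /=; last 2 first.
    - apply/trivIsetP => i j _ _ ij.
      rewrite predeqE => -[n m] /=; split => //= -[] [_] _ [<-{n} _].
      by move=> [m' _] [] /esym/eqP; rewrite (negbTE ij).
    - by move=> /= [n m]; exact: vol_ge0.
  rewrite -(image_id [set: nat]) -fun_true esum_pred_image//; last first.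
    by move=> n _; apply: esum_ge0 => ? _; exact: vol_ge0.
  apply: eq_eseriesr => /= j _.
  rewrite -(esum_pred_image (mu \o uncurry G) (pair j) predT)//=; last 2 first.
    by move=> ? _; exact: vol_ge0.
    by move=> ? ? _ _; exact: (@can_inj _ _ _ snd).
  by congr esum; rewrite predeqE => -[a b]; split; move=> [i _ <-]; exists i.
apply: lee_lim.
- apply: is_cvg_nneseries => n *.
  by apply: nneseries_ge0 => m *; exact: (muG_ge0 (n, m)).
- by apply: is_cvg_nneseries => n *; apply: adde_ge0 => //.
- by near=> n; apply: lee_sum => i _; exact: (PG i).2.
Unshelve. all: by end_near. Qed.

HB.instance Definition _ := isOuterMeasure.Build R _ lebesgue_outer
  lebesgue_outer0 lebesgue_outer_ge0 le_lebesgue_outer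
  lebesgue_outer_sigma_subadditive.

(* R^(D+1) with its Lebesgue measurable sets *)
Definition lebesgue_space := caratheodory_type lebesgue_outer.
HB.instance Definition _ := Measurable.on lebesgue_space.

Definition lebesgue : set lebesgue_space -> \bar R := lebesgue_outer.

Let lebesgue_sigma_additive : semi_sigma_additive lebesgue.
Proof. exact: caratheodory_measure_sigma_additive. Qed.

HB.instance Definition _ := isMeasure.Build _ _ _ lebesgue
  lebesgue_outer0 lebesgue_outer_ge0 lebesgue_sigma_additive.

End lebesgue.
Arguments lebesgue {R D}.

Definition bounded_domain (R : realType) (D : nat) (Q : set 'rV[R]_D) : Prop :=
  [/\ Q !=set0, open Q, connected Q & bounded_set Q].

Section integrable_vector_functions.
Context (R : realType) (D m : nat).
Implicit Types (Q : set (lebesgue_space R D)).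

Definition L1 Q (U : lebesgue_space R D -> 'rV[R]_m) : Prop :=
  measurable_fun Q U /\ (\int[lebesgue]_(y in Q) (enorm (U y))%:E < +oo)%E.

Definition equi_integrable Q (U : nat -> lebesgue_space R D -> 'rV[R]_m) :=
  forall e : R, 0 < e -> exists2 d : R, 0 < d &
    forall (n : nat) (A : set (lebesgue_space R D)),
      measurable A -> A `<=` Q -> (lebesgue A < d%:E)%E ->
      (\int[lebesgue]_(y in A) (enorm (U n y))%:E < e%:E)%E.

End integrable_vector_functions.

Section wasserstein.
Context (R : realType) (m : nat).
Implicit Types mu nu : probability 'rV[R]_m R.

Definition coupling mu nu (g : probability ('rV[R]_m * 'rV[R]_m)%type R) :=
  forall A : set 'rV[R]_m, measurable A ->
    g (A `*` setT) = mu A /\ g (setT `*` A) = nu A.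

Definition wasserstein1 mu nu : \bar R :=
  ereal_inf [set (\int[g]_z (enorm (z.1 - z.2))%:E)%E | g in coupling mu nu].

End wasserstein.

(* All sequences are indexed from 0: [weight n N] is s_(n+1,N+1). *)
Record regular_summation (R : realType) := RegularSummation {
  weight :> nat -> nat -> R ;
  weight_ge0 : forall n N, 0 <= weight n N ;
  weight_bounded : exists sbar : R, forall n N, weight n N <= sbar ;
  weight_triangular : forall n N, (N < n)%N -> weight n N = 0 ;
  weight_sum : forall N, \sum_(n < N.+1) weight n N = N.+1%:R }.

Section empirical.
Context (R : realType) (m : nat).
Variables (s : regular_summation R) (N : nat) (x : nat -> 'rV[R]_m).

Definition empirical : set 'rV[R]_m -> \bar R :=
  mscale (N.+1%:R^-1)%:nng
    (msum (fun n => mscale (NngNum (weight_ge0 s n N)) \d_(x n)) N.+1).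

HB.instance Definition _ := Measure.on empirical.

Let empirical_setT : empirical setT = 1%E.
Proof.
rewrite /empirical /mscale/= /msum.
rewrite (eq_bigr (fun n : 'I_N.+1 => (s n N)%:E)) => [|n _].
  by rewrite sumEFin weight_sum -EFinM mulVf.
by rewrite /= /mscale/= diracT mule1.
Qed.

HB.instance Definition _ :=
  Measure_isProbability.Build _ _ _ empirical empirical_setT.

End empirical.

Section S_convergence.
Context (R : realType) (D m : nat).
Variables (Q : set (lebesgue_space R D)).
Implicit Types (U : nat -> lebesgue_space R D -> 'rV[R]_m)
  (V : lebesgue_space R D -> probability 'rV[R]_m R).

(* The library integral of a non-measurable nonnegative function is a lower
   integral, hence the explicit measurability of the integrand. *)
Definition S_convergent (s : regular_summation R) U V : Prop :=
  let w N y := wasserstein1 (empirical s N (U ^~ y)) (V y) in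
  (forall N, measurable_fun Q (w N)) /\
  (\int[lebesgue]_(y in Q) w N y @[N --> \oo] --> 0)%E.

Definition subsequence (nu : nat -> nat) : Prop :=
  {homo nu : i j / (i < j)%N}.

Definition completely_S_convergent U V : Prop :=
  forall (s : regular_summation R) (nu : nat -> nat), subsequence nu ->
    S_convergent s (U \o nu) V.

End S_convergence.

(* Main.v *)
(* The values are quantized: R^m is cut by half-spaces with rational data into
   nested finite partitions, so that only countably many sets
   [U_n in the first i cells of level L] matter. Iterated limits along an
   ultrafilter yield a subsequence along which the Gram matrix
   |F_j `&` F_k| of each of these sequences of sets is constant up to a summable
   error. Hence a combination of the indicators with zero total weight has L^2
   norm of the order of its largest weight, and every bounded weighted mean of
   every further subsequence has the same L^1 limit G (Banach-Saks). These limits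
   are the cumulative masses of the cells: they split [0, 1] into nested
   intervals, and V_y is the law of the limit of the cell centers under the
   uniform measure. The distance from an empirical measure to V_y is bounded by
   matching equal cells, at the price of the quantization error, which
   equi-integrability makes uniformly small. For the measurability of the distance
   in y, it is the infimum of the costs of countably many rational partial
   transport plans between cells. *)
Require Import Defs.
From HB Require Import structures.
From mathcomp Require Import all_boot all_order all_algebra.
From mathcomp Require Import all_classical all_reals all_analysis.
From mathcomp Require Import measurable_realfun.
From mathcomp Require Import lra ring zify.
Import Order.TTheory GRing.Theory Num.Theory.
Import numFieldNormedType.Exports.
Set Implicit Arguments.
Unset Strict Implicit.
Unset Printing Implicit Defensive.
Local Open Scope classical_set_scope.
Local Open Scope ring_scope.

(** * Couplings *)

(** One subsequence has to serve uncountably many summation methods and further subsequences, so no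
    diagonal argument over them is available. It is replaced by an estimate that sees a mean only
    through its largest weight: a regular method gives at most [sbar / N.+1], and an injective
    reindexing does not increase it. Indicators make this possible without any bound on [U_n], since
    the entries of their Gram matrices stay in a fixed compact interval. The sets are cumulative,
    [cell L (U_n y) < i], rather than single cells, because their inclusions and their nesting
    across levels are exact. Limits defined at every point by [lsup] of explicit means inherit
    monotonicity and nesting at every point, and no null set has to be discarded before [V_y] is
    defined. Nothing bounds the first moment of [V_y] at a given [y]. This is why the limit of the
    centers is controlled only after integration in [y], and why the measurability of the distance
    has to allow infinite values. *)

Section mass_one.
Context d (T : measurableType d) (R : realType) (g : {measure set T -> \bar R}).
Hypothesis gT : g setT = 1%E.

(* A copy of [g] under a fresh head symbol, to which the canonical structure of a
   probability can be attached. *)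
Let mass_one : set T -> \bar R := mscale 1%:nng g.
HB.instance Definition _ := Measure.on mass_one.

Let mass_oneT : mass_one setT = 1%E.
Proof. by rewrite /mass_one /mscale/= mul1e. Qed.

HB.instance Definition _ :=
  Measure_isProbability.Build _ _ _ mass_one mass_oneT.

Lemma probability_of_measure : exists P : probability T R, P = g :> (set T -> \bar R).
Proof.
by exists mass_one; apply/funext => A; rewrite /= /mass_one /mscale/= mul1e.
Qed.

End mass_one.

(** With [a i] the mass of a set in cell [i], this computes a marginal of the measure with density
    [c i j / (p i * q j)] on each pair of cells. Division by [0] giving [0] is harmless: [q j = 0]
    forces [c i j = 0], and [p i = 0] forces [a i = 0]. *)
Lemma sum_transport_weights (R : realType) (M : nat) (c : nat -> nat -> R)
    (p q a : nat -> R) :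
  (forall i j, 0 <= c i j) ->
  (forall i, (i < M)%N -> \sum_(j < M) c i j = p i) ->
  (forall j, (j < M)%N -> \sum_(i < M) c i j = q j) ->
  (forall i, p i = 0 -> a i = 0) ->
  \sum_(i < M) \sum_(j < M) c i j / (p i * q j) * (a i * q j) =
  \sum_(i < M) a i.
Proof.
move=> c0 cp cq pa; apply: eq_bigr => i _.
have cij0 (j : 'I_M) : q j = 0 -> c i j = 0.
  move=> qj0; apply/eqP; rewrite eq_le c0 andbT -qj0 -cq//.
  by rewrite (bigD1 i)//= lerDl sumr_ge0.
transitivity (\sum_(j < M) c i j * (a i / p i)).
  apply: eq_bigr => j _; have [qj0|qj0] := eqVneq (q j) 0.
    by rewrite cij0// !mul0r.
  by rewrite invfM; move: (p i)^-1 => r; field.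
rewrite -mulr_suml cp//; have [pi0|pi0] := eqVneq (p i) 0.
  by rewrite pa// mul0r mulr0.
by rewrite mulrCA mulfV// mulr1.
Qed.

Section coupling_from_matrix.
Context (R : realType) d1 d2 (S1 : measurableType d1) (S2 : measurableType d2).
Variables (P1 : probability S1 R) (P2 : probability S2 R) (M : nat).
Variables (k1 : S1 -> nat) (k2 : S2 -> nat).
Hypotheses (mk1 : forall i, measurable (k1 @^-1` [set i]))
  (mk2 : forall i, measurable (k2 @^-1` [set i])).
Hypotheses (k1M : forall x, (k1 x < M)%N) (k2M : forall x, (k2 x < M)%N).
Let p i := fine (P1 (k1 @^-1` [set i])).
Let q i := fine (P2 (k2 @^-1` [set i])).

Lemma sum_cells d (S : measurableType d) (P : probability S R) (k : S -> nat) A :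
  (forall i, measurable (k @^-1` [set i])) -> (forall x, (k x < M)%N) ->
  measurable A ->
  (\sum_(i < M) fine (P (A `&` k @^-1` [set (i : nat)])))%:E = P A.
Proof.
move=> mk kM mA; rewrite -sumEFin.
transitivity (\sum_(i < M) P (A `&` k @^-1` [set (i : nat)]))%E.
  apply: eq_bigr => i _; rewrite fineK// fin_num_measure//.
  exact: measurableI.
rewrite -measure_bigsetU_ord; last 2 first.
  by move=> i; exact: measurableI.
  by move=> i j _ _ [x [[_ /= ki] [_ /= kj]]]; apply/val_inj; rewrite /= -ki.
have -> := esym (bigcup_mkord M (fun i => A `&` k @^-1` [set i])).
congr (P _); apply/seteqP; split => x.
  by move=> [i _ []].
by move=> Ax; exists (k x) => //=; exact: kM.
Qed.

(** The coupling is the product measure with density [c i j / (p i * q j)] on the product of the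
    cells [i] and [j]: given the two cells, the two points are independent. *)
Lemma coupling_from_matrix (c : nat -> nat -> R) :
  (forall i j, 0 <= c i j) ->
  (forall i, (i < M)%N -> \sum_(j < M) c i j = p i) ->
  (forall j, (j < M)%N -> \sum_(i < M) c i j = q j) ->
  exists g : probability (S1 * S2)%type R,
    [/\ forall A, measurable A -> g (A `*` setT) = P1 A,
        forall A, measurable A -> g (setT `*` A) = P2 A &
        forall i j, (i < M)%N -> (j < M)%N ->
          g ((k1 @^-1` [set i]) `*` (k2 @^-1` [set j])) = (c i j)%:E].
Proof.
move=> c0 cp cq.
have th0 i j : 0 <= c i j / (p i * q j).
  by rewrite divr_ge0// mulr_ge0// fine_ge0.
have mS i j : measurable ((k1 @^-1` [set i]) `*` (k2 @^-1` [set j])).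
  exact: measurableX.
pose g : {measure set (S1 * S2)%type -> \bar R} :=
  msum (fun i => msum (fun j =>
    mscale (NngNum (th0 i j)) (mrestr (P1 \x P2)%E (mS i j))) M) M.
pose a A i := fine (P1 (A `&` k1 @^-1` [set i])).
pose b A i := fine (P2 (A `&` k2 @^-1` [set i])).
have gE A B : measurable A -> measurable B -> g (A `*` B) =
    (\sum_(i < M) \sum_(j < M) c i j / (p i * q j) * (a A i * b B j))%:E.
  move=> mA mB; rewrite /g/= /msum/= -sumEFin; apply: eq_bigr => i _.
  rewrite /msum/= -sumEFin; apply: eq_bigr => j _.
  transitivity ((c i j / (p i * q j))%:E * (P1 \x P2)%E
    ((A `*` B) `&` ((k1 @^-1` [set (i : nat)]) `*` (k2 @^-1` [set (j : nat)]))))%E => //.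
  rewrite [RHS]EFinM -setXI; congr (_ * _)%E.
  rewrite product_measure1E; [|exact: measurableI..].
  by rewrite EFinM !fineK// fin_num_measure//; exact: measurableI.
have aT i : a setT i = p i by rewrite /a setTI.
have bT i : b setT i = q i by rewrite /b setTI.
have a0 A : measurable A -> forall i, p i = 0 -> a A i = 0.
  move=> mA i pi0; apply/eqP; rewrite eq_le fine_ge0// andbT -pi0.
  by rewrite fine_le ?fin_num_measure ?le_measure ?inE//; exact: measurableI.
have b0 A : measurable A -> forall i, q i = 0 -> b A i = 0.
  move=> mA i pi0; apply/eqP; rewrite eq_le fine_ge0// andbT -pi0.
  by rewrite fine_le ?fin_num_measure ?le_measure ?inE//; exact: measurableI.
have g1 A : measurable A -> g (A `*` setT) = P1 A.
  move=> mA; rewrite gE//.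
  under eq_bigr do under eq_bigr do rewrite bT.
  by rewrite (sum_transport_weights c0 cp cq (a0 _ mA)) sum_cells.
have g2 A : measurable A -> g (setT `*` A) = P2 A.
  move=> mA; rewrite gE//.
  under eq_bigr do under eq_bigr do rewrite aT.
  rewrite exchange_big/=.
  under eq_bigr do under eq_bigr do rewrite (mulrC (p _) (q _)) (mulrC (p _) (b _ _)).
  rewrite (@sum_transport_weights _ _ (fun i j => c j i) q p)// ?sum_cells//.
  exact: b0.
have gT : g setT = 1%E by rewrite -setXTT g1// probability_setT.
have [G GE] := probability_of_measure gT.
exists G; rewrite GE; split => //.
move=> i j iM jM; rewrite [LHS]gE//.
have aE i' : a (k1 @^-1` [set i]) i' = if i' == i then p i else 0.
  rewrite /a; case: eqVneq => [->|ii']; first by rewrite setIid.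
  rewrite (_ : _ `&` _ = set0) ?measure0//; apply/seteqP; split => // x.
  by case=> /= xi xi'; move: ii'; rewrite -xi' xi eqxx.
have bE i' : b (k2 @^-1` [set j]) i' = if i' == j then q j else 0.
  rewrite /b; case: eqVneq => [->|ii']; first by rewrite setIid.
  rewrite (_ : _ `&` _ = set0) ?measure0//; apply/seteqP; split => // x.
  by case=> /= xi xi'; move: ii'; rewrite -xi' xi eqxx.
rewrite (bigD1 (Ordinal iM))//= [X in _ + X]big1 ?addr0; last first.
  move=> i' /negPf ii'; rewrite big1// => j' _; rewrite aE.
  by rewrite (_ : _ == i = false) ?mul0r ?mulr0.
rewrite (bigD1 (Ordinal jM))//= [X in _ + X]big1 ?addr0; last first.
  move=> i' /negPf ii'; rewrite bE.
  by rewrite (_ : _ == j = false) ?mul0r ?mulr0.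
rewrite aE bE !eqxx; congr EFin.
have [pq0|pq0] := eqVneq (p i * q j) 0; last by rewrite divfK.
rewrite pq0 mulr0; apply/esym/eqP; rewrite eq_le c0 andbT.
move/eqP: pq0; rewrite mulf_eq0 => /orP[] /eqP <-.
  by rewrite -cp// (bigD1 (Ordinal jM))//= lerDl sumr_ge0.
by rewrite -cq// (bigD1 (Ordinal iM))//= lerDl sumr_ge0.
Qed.

End coupling_from_matrix.

(** * Euclidean norm, Borel sets and nested cells *)

Section euclidean_norm.
Context (R : realType) (m : nat).
Implicit Types x y z : 'rV[R]_m.+1.

Lemma enorm_ge0 x : 0 <= enorm x.
Proof. exact: sqrtr_ge0. Qed.

Lemma enorm0 : enorm (0 : 'rV[R]_m.+1) = 0.
Proof. by rewrite /enorm big1 ?sqrtr0// => i _; rewrite mxE expr0n. Qed.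

Lemma enormN x : enorm (- x) = enorm x.
Proof. by congr Num.sqrt; apply: eq_bigr => i _; rewrite mxE sqrrN. Qed.

Lemma enormB x y : enorm (x - y) = enorm (y - x).
Proof. by rewrite -enormN opprB. Qed.

Lemma sqr_enorm x : enorm x ^+ 2 = \sum_(i < m.+1) x ord0 i ^+ 2.
Proof. by rewrite sqr_sqrtr// sumr_ge0// => i _; exact: sqr_ge0. Qed.

Lemma coord_le_enorm x i : `|x ord0 i| <= enorm x.
Proof.
rewrite -sqrtr_sqr ler_sqrt; last by apply: sumr_ge0 => j _; exact: sqr_ge0.
by rewrite (bigD1 i)//= lerDl sumr_ge0// => j _; exact: sqr_ge0.
Qed.

Lemma enorm_eq0 x : enorm x = 0 -> x = 0.
Proof.
move=> x0; apply/rowP => i; rewrite mxE; apply/eqP.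
by rewrite -normr_eq0 eq_le normr_ge0 -{1}x0 coord_le_enorm.
Qed.

Lemma enorm_le_coord x (e : R) : 0 <= e -> (forall i, `|x ord0 i| <= e) ->
  enorm x <= e * m.+1%:R.
Proof.
move=> e0 xe; have em0 : 0 <= e * m.+1%:R by rewrite mulr_ge0.
rewrite -(ger0_norm em0) -sqrtr_sqr ler_sqrt ?sqr_ge0//.
apply: (@le_trans _ _ (\sum_(i < m.+1) e ^+ 2)).
  apply: ler_sum => i _; rewrite -(real_normK (num_real (x _ _))).
  by rewrite lerXn2r ?nnegrE.
rewrite sumr_const card_ord -[leLHS]mulr_natr exprMn; apply: ler_wpM2l; first exact: sqr_ge0.
by rewrite -natrX ler_nat expnS leq_pmulr// expn_gt0.
Qed.

Lemma cauchy_schwarz x y :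
  \sum_(i < m.+1) x ord0 i * y ord0 i <= enorm x * enorm y.
Proof.
have [x0|x0] := eqVneq (enorm x) 0.
  rewrite x0 mul0r big1// => i _; rewrite (enorm_eq0 x0) mxE mul0r//.
have [y0|y0] := eqVneq (enorm y) 0.
  rewrite y0 mulr0 big1// => i _; rewrite (enorm_eq0 y0) mxE mulr0//.
have xp : 0 < enorm x by rewrite lt_def x0 enorm_ge0.
have yp : 0 < enorm y by rewrite lt_def y0 enorm_ge0.
set a := enorm x in x0 xp *; set b := enorm y in y0 yp *.
(* Young's inequality, weighted so that each of the two sums equals [a * b / 2]. *)
apply: (@le_trans _ _
    (\sum_(i < m.+1) (b / a / 2 * x ord0 i ^+ 2 + a / b / 2 * y ord0 i ^+ 2))).
  apply: ler_sum => i _; set u := x _ _; set v := y _ _.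
  have -> : b / a / 2 * u ^+ 2 + a / b / 2 * v ^+ 2 =
      u * v + (b * u - a * v) ^+ 2 / (2 * a * b) by field; rewrite x0 y0.
  by rewrite lerDl divr_ge0 ?sqr_ge0// !mulr_ge0// ltW.
rewrite big_split/= -!mulr_sumr -!sqr_enorm -/a -/b.
by rewrite le_eqVlt; apply/orP; left; apply/eqP; field; rewrite x0 y0.
Qed.

Lemma ler_enormD x y : enorm (x + y) <= enorm x + enorm y.
Proof.
rewrite -(@ler_pXn2r _ 2)// ?nnegrE ?addr_ge0 ?enorm_ge0//.
rewrite sqrrD !sqr_enorm.
under eq_bigr do rewrite mxE sqrrD.
rewrite !big_split/= lerD2r lerD2l.
by rewrite [leRHS]mulr2n lerD// cauchy_schwarz.
Qed.

Lemma ler_enormB x y : enorm (x - y) <= enorm x + enorm y.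
Proof. by rewrite (le_trans (ler_enormD _ _))// enormN. Qed.

Lemma ler_enorm_dist z x y : enorm (x - y) <= enorm (x - z) + enorm (z - y).
Proof. by rewrite -[in leLHS](subrKA z) ler_enormD. Qed.

End euclidean_norm.

Section borel_rows.
Context (R : realType) (n : nat).
Local Notation V := 'rV[R]_n.+1.

Definition rat_box (ab : 'rV[rat]_n.+1 * 'rV[rat]_n.+1) : set V :=
  box (map_mx ratr ab.1, map_mx ratr ab.2).

Lemma open_bigcup_rat_box (O : set V) : open O ->
  O = \bigcup_(ab in [set ab | rat_box ab `<=` O]) rat_box ab.
Proof.
move=> oO; apply/seteqP; split; last by move=> x [ab abO /abO].
move=> x Ox; have : nbhs x O by exact: open_nbhs_nbhs.
move/nbhs_ballP => [e /= e0 xeO].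
have lo i : {q : rat | x ord0 i - e < ratr q < x ord0 i}.
  have /rat_in_itvoo/cid[q] : x ord0 i - e < x ord0 i by rewrite ltrBlDr ltrDl.
  by rewrite in_itv/= => h; exists q.
have hi i : {q : rat | x ord0 i < ratr q < x ord0 i + e}.
  have /rat_in_itvoo/cid[q] : x ord0 i < x ord0 i + e by rewrite ltrDl.
  by rewrite in_itv/= => h; exists q.
exists (\row_i sval (lo i), \row_i sval (hi i)) => /=; last first.
  move=> i; rewrite !mxE; case: (lo i) (hi i) => [a /= /andP[_ ->]] [b /=].
  by move=> /andP[->].
move=> y yab; apply: xeO; split => // i j; rewrite (ord1 i) /ball/=.
move: (yab j); rewrite /= !mxE; case: (lo j) (hi j) => [a /= /andP[h1 h2]] [b /=].
by move=> /andP[h3 h4] /andP[h5 h6]; rewrite ltr_norml; apply/andP; split; lra.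
Qed.

Lemma open_rV_measurable (O : set V) : open O -> measurable O.
Proof. by move=> oO; exact: sub_sigma_algebra. Qed.

Lemma coord_measurable (i : 'I_n.+1) :
  measurable_fun setT (fun x : V => x ord0 i).
Proof.
apply: (measurability _ (RGenOpens.measurableE R)).
move=> _ [_ [a [b ->] <-]]; rewrite setTI; apply: open_rV_measurable.
by apply: open_comp; [move=> x _; exact: coord_continuous|exact: interval_open].
Qed.

(** Open sets are countable unions of rational boxes, whose preimages are finite intersections over
    the coordinates. *)
Lemma measurable_fun_rV d (T : measurableType d) (f : T -> V) :
  (forall i, measurable_fun setT (fun x => f x ord0 i)) ->
  measurable_fun setT f.
Proof.
move=> mf; apply: (@measurability _ _ _ _ _ _ (@open V) erefl) => // _ [A oA <-].
rewrite setTI (open_bigcup_rat_box oA) preimage_bigcup bigcup_mkcond.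
apply: countable_bigcupT_measurable => // ab; case: ifPn => // _.
rewrite (_ : _ @^-1` _ = \bigcap_(i in [set: 'I_n.+1])
    ((fun x => f x ord0 i) @^-1` `]ratr (ab.1 ord0 i), ratr (ab.2 ord0 i)[)).
  by apply: fin_bigcap_measurable => // i _; rewrite -[X in measurable X]setTI;
    apply: mf.
apply/seteqP; split => x /=.
  by move=> h i _; have := h i; rewrite /= !mxE in_itv.
by move=> h i; have := h i I; rewrite /= !mxE in_itv.
Qed.

Lemma measurable_fun_coord d (T : measurableType d) (f : T -> V) i :
  measurable_fun setT f -> measurable_fun setT (fun x => f x ord0 i).
Proof. by move=> mf; apply: (measurableT_comp (coord_measurable i) mf). Qed.

Lemma measurable_enorm d (T : measurableType d) (f : T -> V) :
  measurable_fun setT f -> measurable_fun setT (fun x => enorm (f x)).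
Proof.
move=> mf; apply: (@measurableT_comp _ _ _ _ _ _ (@Num.sqrt R)).
  by apply: continuous_measurable_fun; exact: sqrt_continuous.
apply: measurable_sum => i; apply: measurable_funX.
exact: measurable_fun_coord.
Qed.

Lemma measurable_rVB d (T : measurableType d) (f g : T -> V) :
  measurable_fun setT f -> measurable_fun setT g ->
  measurable_fun setT (fun x => f x - g x).
Proof.
move=> mf mg; apply: measurable_fun_rV => i.
under eq_fun do rewrite mxE.
rewrite (_ : (fun x => _) = (fun x => f x ord0 i - g x ord0 i)).
  by apply: measurable_funB; exact: measurable_fun_coord.
by apply/funext => x; rewrite mxE.
Qed.

Lemma measurable_dist d (T : measurableType d) (f g : T -> V) :
  measurable_fun setT f -> measurable_fun setT g ->
  measurable_fun setT (fun x => (enorm (f x - g x))%:E).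
Proof.
move=> mf mg; apply/measurable_EFinP; apply: measurable_enorm.
exact: measurable_rVB.
Qed.

End borel_rows.

Section quantization.
Context (R : realType) (n : nat).
Local Notation V := 'rV[R]_n.+1.

(* The tests [x_i < q] for all coordinates [i] and rationals [q], enumerated. *)
Definition test (j : nat) (x : V) : bool :=
  if @unpickle ('I_n.+1 * rat)%type j is Some iq
  then x ord0 iq.1 < ratr iq.2 else false.

(* The answers to the first [L] tests, read as a binary number below [2 ^ L]:
   the cells of level [L] are refined, in order, by those of level [L.+1]. *)
Fixpoint cell (L : nat) (x : V) : nat :=
  if L is L'.+1 then test L' x + (cell L' x).*2 else 0.

Lemma cell_lt L x : (cell L x < 2 ^ L)%N.
Proof.
elim: L => //= L IH; rewrite expnS mul2n -!muln2.
by case: (test L x); lia.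
Qed.

Lemma cell_test L j x y : (j < L)%N -> cell L x = cell L y -> test j x = test j y.
Proof.
elim: L => // L IH; rewrite ltnS leq_eqVlt => /orP[/eqP ->|jL] /= xy.
  by move: (congr1 odd xy); rewrite !oddD !odd_double !addbF !oddb.
apply: IH => //; move: (congr1 half xy).
by rewrite !halfD !odd_double !doubleK !andbF; case: (test _ _) (test _ _) => [] [].
Qed.

Lemma measurable_test j : measurable [set x | test j x].
Proof.
rewrite /test; case: unpickle => [[i q]|] /=.
  have := coord_measurable i measurableT (@measurable_itv R `]-oo, ratr q[%R).
  rewrite setTI (_ : _ @^-1` _ = [set x : V | x ord0 i < ratr q])//.
have E : [set _ : V | false] = set0 by apply/seteqP; split.
by rewrite E.
Qed.

Lemma measurable_cell L i : measurable (cell L @^-1` [set i]).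
Proof.
elim: L i => [|L IH] i /=.
  by rewrite preimage_cst; case: ifP.
rewrite (_ : _ @^-1` _ =
  ((cell L @^-1` [set i./2]) `&` [set x | test L x = odd i])).
  apply: measurableI => //; case: (odd i); first exact: (measurable_test L).
  rewrite (_ : [set _ | _] = ~` [set x | test L x]).
    by apply: measurableC; exact: (measurable_test L).
  by apply/seteqP; split => x /= => [->//|/negP/negPf].
apply/seteqP; split => x /=.
  move=> <-; rewrite halfD oddD !odd_double !doubleK.
  by case: (test L x) => /=; rewrite ?addn0 ?addbF.
by move=> [-> ->]; rewrite odd_double_half.
Qed.

Lemma measurable_cell_lt L i : measurable [set x : V | (cell L x < i)%N].
Proof.
rewrite (_ : [set _ | _] = \bigcup_(j in [set j | (j < i)%N]) (cell L @^-1` [set j])).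
  by apply: bigcup_measurable => j _; exact: measurable_cell.
apply/seteqP; split => x /=; first by move=> xi; exists (cell L x).
by move=> [j /= ji ->].
Qed.

(* The slack [1] is what allows the representative of a cell to have almost
   minimal norm in it. *)
Definition center (L i : nat) : V :=
  xget 0 [set c | cell L c = i /\
                  forall x, cell L x = i -> enorm c <= enorm x + 1].

Definition quant (L : nat) (x : V) : V := center L (cell L x).

Lemma quantP L x : cell L (quant L x) = cell L x /\
  enorm (quant L x) <= enorm x + 1.
Proof.
rewrite /quant /center; case: xgetP => [c _ [cx c1]|]; first by split; auto.
pose E := [set enorm y | y in [set y | cell L y = cell L x]].
have Einf : has_inf E.
  split; first by exists (enorm x), x.
  by exists 0 => _ [y _ <-]; exact: enorm_ge0.
have [_ [c /= cx <-] c1] := inf_adherent ltr01 Einf.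
move=> /(_ c)[]; split => // y yx; apply: (le_trans (ltW c1)).
by rewrite lerD2r; apply: ge_inf; [exact: Einf.2|exists y].
Qed.

(** A bound independent of [L]: it is the integrable majorant for a fixed measure, and it controls
    the large values, which fine cells do not. *)
Lemma dist_quant_le L x : enorm (x - quant L x) <= 2 * enorm x + 1.
Proof.
rewrite (le_trans (ler_enormB _ _))// mulr2n mulrDl mul1r -addrA lerD2l.
exact: (quantP L x).2.
Qed.

Lemma measurable_comp_cell d (T : measurableType d) d' (T' : measurableType d')
    (k : T -> nat) (f : nat -> T') :
  (forall i, measurable (k @^-1` [set i])) -> measurable_fun setT (f \o k).
Proof.
move=> mk _ A mA; rewrite setTI comp_preimage.
rewrite (_ : _ @^-1` _ = \bigcup_(i in f @^-1` A) (k @^-1` [set i])).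
  by apply: bigcup_measurable => i _; exact: mk.
apply/seteqP; split => [x fx|x [i fi kx]]; first by exists (k x).
by move: fi; rewrite -(kx : k x = i).
Qed.

Lemma measurable_quant L : measurable_fun setT (quant L).
Proof. exact: (measurable_comp_cell _ (measurable_cell L)). Qed.

(** Finitely many tests suffice, those on a grid of rational mesh [r < e / n.+1] spanning [[-K, K]]
    in each coordinate. From level [L0] on they have all been answered, so a point and its
    representative lie in the same box of the grid; the answers alone confine the representative,
    whose norm may exceed [K]. *)
Lemma dist_quant_small (K e : R) : 0 < e -> exists L0, forall L, (L0 <= L)%N ->
  forall x, enorm x <= K -> enorm (x - quant L x) <= e.
Proof.
move=> e0; have n0 : 0 < n.+1%:R :> R by [].
have /rat_in_itvoo[r] : 0 < e / n.+1%:R by rewrite divr_gt0.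
rewrite in_itv/= => /andP[r0 re].
pose Z := (Num.trunc (K / ratr r)).+1.
pose grid (k : nat) : rat := r * (k%:R - Z%:R).
pose code (i : 'I_n.+1) (k : nat) := pickle (i, grid k).
exists (\max_(i < n.+1) \max_(k < (Z + Z).+1) (code i k).+1)%N => L L0 x xK.
have codeL i k : (k <= Z + Z)%N -> (code i k < L)%N.
  move=> kZ; apply: leq_trans L0.
  apply: (leq_trans _ (leq_bigmax i)).
  exact: (leq_trans _ (leq_bigmax (Ordinal (kZ : (k < (Z + Z).+1)%N)))).
have same i k : (k <= Z + Z)%N ->
    (x ord0 i < ratr (grid k)) = (quant L x ord0 i < ratr (grid k)).
  move=> kZ; have := cell_test (codeL i k kZ) (esym (quantP L x).1).
  by rewrite /test pickleK.
have gridE k : ratr (grid k) = ratr r * (k%:R - Z%:R) :> R.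
  by rewrite /grid rmorphM/= rmorphB/= !ratr_nat.
have K0 : 0 <= K by apply: le_trans xK; exact: enorm_ge0.
have KZ : K < ratr r * Z%:R.
  by rewrite mulrC -ltr_pdivrMr// truncnS_gt.
rewrite -(divfK (lt0r_neq0 n0) e).
apply: enorm_le_coord; first by rewrite divr_ge0// ltW.
move=> i; rewrite !mxE; apply: le_trans (ltW re).
have /andP[x1 x2] : - K <= x ord0 i <= K.
  by rewrite -ler_norml (le_trans (coord_le_enorm _ _)).
pose k := Num.trunc (x ord0 i / ratr r + Z%:R).
have h0 : 0 <= x ord0 i / ratr r + Z%:R.
  rewrite -lerBlDr sub0r ler_pdivlMr// mulNr lerNl; apply/ltW.
  by rewrite [ltRHS]mulrC (le_lt_trans _ KZ)// lerNl.
have /andP[k1 k2] := truncn_itv h0.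
have kZ : (k.+1 <= Z + Z)%N.
  rewrite truncn_lt_nat// natrD ltrD2r ltr_pdivrMr// mulrC.
  exact: le_lt_trans KZ.
have := same i k (ltnW kZ); have := same i k.+1 kZ; rewrite !gridE.
rewrite -/k in k1 k2.
have xk1 : ratr r * (k%:R - Z%:R) <= x ord0 i.
  by rewrite mulrC -ler_pdivlMr// lerBlDr.
have xk2 : x ord0 i < ratr r * (k.+1%:R - Z%:R).
  by rewrite mulrC -ltr_pdivrMr// ltrBrDr.
rewrite xk2 => /esym xk3; rewrite ltNge xk1/= => /esym/negbT; rewrite -leNgt => xk4.
rewrite ler_norml; apply/andP; move: xk1 xk2 xk3 xk4.
by rewrite -natr1 !mulrBr !mulrDr mulr1; split; lra.
Qed.

End quantization.
Arguments center {R n} L i.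

(** * Push-forwards and integrals of functions of a cell *)

Section pushforward_probability.
Context d d' (T : measurableType d) (T' : measurableType d') (R : realType).

Lemma probability_pushforward (P : probability T R) (f : T -> T') :
  measurable_fun setT f -> exists Q : probability T' R,
    (forall A, Q A = P (f @^-1` A)) /\
    forall h : T' -> \bar R, measurable_fun setT h -> (forall x, 0 <= h x)%E ->
      (\int[Q]_x h x = \int[P]_x h (f x))%E.
Proof.
move=> mf; pose mixin := isMeasurableFun.Build _ _ _ _ f mf.
pose X : {mfun T >-> T'} := HB.pack f mixin.
exists (distribution P X); split => // h mh h0.
by rewrite ge0_integral_distribution.
Qed.

Lemma integral_law (P : probability T R) (Q : probability T' R) (f : T -> T')
    (h : T' -> \bar R) : measurable_fun setT f ->
  (forall A, measurable A -> Q A = P (f @^-1` A)) ->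
  measurable_fun setT h -> (forall x, 0 <= h x)%E ->
  (\int[Q]_x h x = \int[P]_x h (f x))%E.
Proof.
move=> mf QP mh h0; have [Q' [Q'P Q'h]] := probability_pushforward P mf.
rewrite -Q'h//; apply: eq_measure_integral => A mA _.
exact: etrans (QP A mA) (esym (Q'P A)).
Qed.

End pushforward_probability.

Section cell_integral.
Context d (T : measurableType d) (R : realType) (P : probability T R).
Variables (M1 M2 : nat) (k1 k2 : T -> nat).
Hypotheses (mk1 : forall i, measurable (k1 @^-1` [set i]))
  (mk2 : forall i, measurable (k2 @^-1` [set i])).
Hypotheses (k1M : forall x, (k1 x < M1)%N) (k2M : forall x, (k2 x < M2)%N).

Lemma integral_cells2 (h : nat -> nat -> R) : (forall i j, 0 <= h i j) ->
  (\int[P]_x (h (k1 x) (k2 x))%:E = (\sum_(i < M1) \sum_(j < M2) h i j *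
     fine (P (k1 @^-1` [set (i : nat)] `&` k2 @^-1` [set (j : nat)])))%:E)%E.
Proof.
move=> h0; pose A i j := k1 @^-1` [set i] `&` k2 @^-1` [set j].
have mA i j : measurable (A i j) by exact: measurableI.
transitivity (\int[P]_x (\sum_(i < M1) \sum_(j < M2)
    (h i j)%:E * (\1_(A i j) x)%:E))%E.
  apply: eq_integral => x _.
  rewrite (bigD1 (Ordinal (k1M x)))//= [X in (_ + X)%E]big1 ?adde0; last first.
    move=> i /eqP ix; rewrite big1// => j _; rewrite indicE memNset ?mule0//.
    by move=> -[/= xi _]; apply: ix; apply/val_inj.
  rewrite (bigD1 (Ordinal (k2M x)))//= [X in (_ + X)%E]big1 ?adde0; last first.
    move=> i /eqP ix; rewrite indicE memNset ?mule0//.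
    by move=> -[/= _ xi]; apply: ix; apply/val_inj.
  by rewrite indicE mem_set// mule1.
have mh i j : measurable_fun setT (fun x => (h i j)%:E * (\1_(A i j) x)%:E)%E.
  by apply: measurable_funeM; apply/measurable_EFinP; exact: measurable_indic.
have h0' i j x : (0 <= (h i j)%:E * (\1_(A i j) x)%:E)%E.
  by rewrite mule_ge0 ?lee_fin.
rewrite ge0_integral_sum//; last 2 first.
- by move=> i; exact: emeasurable_sum.
- by move=> i x _; exact: sume_ge0.
rewrite -sumEFin; apply: eq_bigr => i _; rewrite ge0_integral_sum//.
rewrite -sumEFin; apply: eq_bigr => j _; rewrite ge0_integralZl_EFin//.
  rewrite integral_indic// setIT EFinM fineK// fin_num_measure//; exact: mA.
by apply/measurable_EFinP; exact: measurable_indic.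
Qed.

End cell_integral.

(** * Upper bounds on the distance from partial transport plans *)

Section wasserstein_upper_bound.
Context (R : realType) (m : nat).
Local Notation V := 'rV[R]_m.+1.
Implicit Types mu nu : probability V R.

(** The law of the pair [(X, Y)] under [g] is a coupling with this cost. *)
Lemma wasserstein1_le d (T : measurableType d) (g : probability T R)
    (X Y : T -> V) mu nu : measurable_fun setT X -> measurable_fun setT Y ->
  (forall A, measurable A -> mu A = g (X @^-1` A)) ->
  (forall A, measurable A -> nu A = g (Y @^-1` A)) ->
  (wasserstein1 mu nu <= \int[g]_x (enorm (X x - Y x))%:E)%E.
Proof.
move=> mX mY muX nuY; have mXY : measurable_fun setT (fun x => (X x, Y x)).
  exact: measurable_fun_pair.
have [G [GE Gh]] := probability_pushforward g mXY.
rewrite -(Gh (fun z => (enorm (z.1 - z.2))%:E)); last 2 first.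
- exact: (measurable_dist measurable_fst measurable_snd).
- by move=> z; rewrite lee_fin enorm_ge0.
apply: ereal_inf_lbound; exists G => // A mA; split.
  rewrite muX// GE; congr (g _); apply/seteqP; split => x /=; first by case.
  by split.
rewrite nuY// GE; congr (g _); apply/seteqP; split => x /=; first by case.
by split.
Qed.

(* The masses left over by the partial plan [c] are matched by their product,
   every unit being carried through the origin. *)
Lemma complete_transport (M : nat) (c : nat -> nat -> R) (p q : nat -> R) :
  (forall i j, 0 <= c i j) -> (forall i, \sum_(j < M) c i j <= p i) ->
  (forall j, \sum_(i < M) c i j <= q j) ->
  \sum_(i < M) p i = \sum_(j < M) q j ->
  let a i := p i - \sum_(j < M) c i j in let b j := q j - \sum_(i < M) c i j in
  exists c' : nat -> nat -> R, [/\ forall i j, 0 <= c' i j,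
    forall i, (i < M)%N -> \sum_(j < M) c' i j = p i,
    forall j, (j < M)%N -> \sum_(i < M) c' i j = q j &
    forall e : nat -> R, (forall i, 0 <= e i) ->
    forall h : nat -> nat -> R, (forall i j, h i j <= e i + e j) ->
      \sum_(i < M) \sum_(j < M) c' i j * h i j <=
      \sum_(i < M) \sum_(j < M) c i j * h i j +
      \sum_(i < M) a i * e i + \sum_(j < M) b j * e j].
Proof.
move=> c0 cp cq pq a b; pose r := \sum_(i < M) a i.
have a0 i : 0 <= a i by rewrite subr_ge0.
have b0 j : 0 <= b j by rewrite subr_ge0.
have rb : r = \sum_(j < M) b j.
  by rewrite /r /a /b !sumrB pq exchange_big.
have r0 : 0 <= r by exact: sumr_ge0.
(* If nothing is left over, [r = 0] and every [a i] vanishes, so the product plan keeps its meaning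
   with division by [0]. *)
have ar i : (i < M)%N -> a i * r / r = a i.
  move=> iM; have [rr|rr] := eqVneq r 0; last by rewrite mulfK.
  rewrite rr mulr0 mul0r; apply/esym/eqP; rewrite eq_le a0 andbT -rr /r.
  by rewrite (bigD1 (Ordinal iM))//= lerDl sumr_ge0.
have br i : (i < M)%N -> b i * r / r = b i.
  move=> iM; have [rr|rr] := eqVneq r 0; last by rewrite mulfK.
  rewrite rr mulr0 mul0r; apply/esym/eqP; rewrite eq_le b0 andbT -rr rb.
  by rewrite (bigD1 (Ordinal iM))//= lerDl sumr_ge0.
have sa i : (i < M)%N -> \sum_(j < M) a i * b j / r = a i.
  by move=> iM; rewrite -mulr_suml -mulr_sumr -rb ar.
have sb j : (j < M)%N -> \sum_(i < M) a i * b j / r = b j.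
  by move=> jM; rewrite -mulr_suml -mulr_suml -/r (mulrC r) br.
exists (fun i j => c i j + a i * b j / r); split.
- by move=> i j; rewrite addr_ge0// divr_ge0// mulr_ge0.
- by move=> i iM; rewrite big_split/= sa// addrC subrK.
- by move=> j jM; rewrite big_split/= sb// addrC subrK.
move=> e e0 h he.
under eq_bigr do under eq_bigr do rewrite mulrDl.
under eq_bigr do rewrite big_split/=.
rewrite big_split/= -addrA lerD2l.
have -> : \sum_(i < M) a i * e i + \sum_(j < M) b j * e j =
    \sum_(i < M) \sum_(j < M) a i * b j / r * (e i + e j).
  under [RHS]eq_bigr do under eq_bigr do rewrite mulrDr.
  under [RHS]eq_bigr do rewrite big_split/=.
  rewrite big_split/=; congr (_ + _).
    by apply: eq_bigr => i _; rewrite -mulr_suml sa.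
  rewrite exchange_big/=; apply: eq_bigr => j _.
  by rewrite -mulr_suml sb.
apply: ler_sum => i _; apply: ler_sum => j _.
by apply: ler_wpM2l => //; rewrite divr_ge0// mulr_ge0.
Qed.

(** Mass travels from [X1] to the representative of its label, then along the completed plan, then
    from a representative to [X2]. The measures are given as laws of random variables with labels of
    their own because the limit law will be realized on [[0, 1]], where the label of a point need
    not be the cell of its value. *)
Lemma wasserstein1_le_cells d1 d2 (S1 : measurableType d1)
    (S2 : measurableType d2) (P1 : probability S1 R) (P2 : probability S2 R)
    (X1 : S1 -> V) (X2 : S2 -> V) mu nu (M : nat) (k1 : S1 -> nat)
    (k2 : S2 -> nat) (x : nat -> V) (c : nat -> nat -> R) :
  measurable_fun setT X1 -> measurable_fun setT X2 ->
  (forall A, measurable A -> mu A = P1 (X1 @^-1` A)) ->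
  (forall A, measurable A -> nu A = P2 (X2 @^-1` A)) ->
  (forall i, measurable (k1 @^-1` [set i])) ->
  (forall i, measurable (k2 @^-1` [set i])) ->
  (forall s, k1 s < M)%N -> (forall s, k2 s < M)%N ->
  let p i := fine (P1 (k1 @^-1` [set i])) in
  let q j := fine (P2 (k2 @^-1` [set j])) in
  (forall i j, 0 <= c i j) -> (forall i, \sum_(j < M) c i j <= p i) ->
  (forall j, \sum_(i < M) c i j <= q j) ->
  (wasserstein1 mu nu <= \int[P1]_s (enorm (X1 s - x (k1 s)))%:E +
    \int[P2]_s (enorm (X2 s - x (k2 s)))%:E +
    (\sum_(i < M) \sum_(j < M) c i j * enorm (x i - x j) +
     \sum_(i < M) (p i - \sum_(j < M) c i j) * enorm (x i) +
     \sum_(j < M) (q j - \sum_(i < M) c i j) * enorm (x j))%:E)%E.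
Proof.
move=> mX1 mX2 muX nuX mk1 mk2 k1M k2M p q c0 cp cq.
have pq : \sum_(i < M) p i = \sum_(j < M) q j.
  have := sum_cells P1 mk1 k1M measurableT.
  have := sum_cells P2 mk2 k2M measurableT.
  under eq_bigr do rewrite setTI.
  under [in X in _ -> X -> _]eq_bigr do rewrite setTI.
  by rewrite !probability_setT => -[<-] [].
have [c' [c'0 c'p c'q c'h]] := complete_transport c0 cp cq pq.
have [g [g1 g2 gc]] := coupling_from_matrix mk1 mk2 k1M k2M c'0 c'p c'q.
have mx1 : measurable_fun setT (x \o k1) by exact: measurable_comp_cell.
have mx2 : measurable_fun setT (x \o k2) by exact: measurable_comp_cell.
have mX1' : measurable_fun setT (X1 \o fst : S1 * S2 -> V).
  exact: measurableT_comp.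
have mX2' : measurable_fun setT (X2 \o snd : S1 * S2 -> V).
  exact: measurableT_comp.
apply: le_trans (wasserstein1_le (g := g) mX1' mX2' _ _) _.
- move=> A mA; rewrite muX// -g1; last first.
    by rewrite -[X in measurable X]setTI; exact: mX1.
  by congr (g _); apply/seteqP; split => -[s t]//= [].
- move=> A mA; rewrite nuX// -g2; last first.
    by rewrite -[X in measurable X]setTI; exact: mX2.
  by congr (g _); apply/seteqP; split => -[s t]//= [].
have I1 (h : S1 -> \bar R) : measurable_fun setT h -> (forall s, 0 <= h s)%E ->
    (\int[P1]_s h s = \int[g]_z h z.1)%E.
  move=> mh h0; apply: integral_law => // A mA; rewrite -g1//.
  by congr (g _); apply/seteqP; split => -[s t]//= [].
have I2 (h : S2 -> \bar R) : measurable_fun setT h -> (forall s, 0 <= h s)%E ->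
    (\int[P2]_s h s = \int[g]_z h z.2)%E.
  move=> mh h0; apply: integral_law => // A mA; rewrite -g2//.
  by congr (g _); apply/seteqP; split => -[s t]//= [].
have d0 (y z : V) : (0 <= (enorm (y - z))%:E)%E by rewrite lee_fin enorm_ge0.
rewrite (I1 (fun s => (enorm (X1 s - x (k1 s)))%:E))//; last exact: measurable_dist.
rewrite (I2 (fun s => (enorm (X2 s - x (k2 s)))%:E))//; last exact: measurable_dist.
have mk1' i : measurable ((k1 \o fst : S1 * S2 -> nat) @^-1` [set i]).
  by rewrite comp_preimage -[X in measurable X]setTI; exact: measurable_fst.
have mk2' i : measurable ((k2 \o snd : S1 * S2 -> nat) @^-1` [set i]).
  by rewrite comp_preimage -[X in measurable X]setTI; exact: measurable_snd.
have m1 : measurable_fun setT (fun z : S1 * S2 => (enorm (X1 z.1 - x (k1 z.1)))%:E).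
  by apply: measurable_dist => //; exact: (measurableT_comp mx1 measurable_fst).
have m2 : measurable_fun setT (fun z : S1 * S2 => (enorm (X2 z.2 - x (k2 z.2)))%:E).
  by apply: measurable_dist => //; exact: (measurableT_comp mx2 measurable_snd).
have m3 : measurable_fun setT (fun z : S1 * S2 => (enorm (x (k1 z.1) - x (k2 z.2)))%:E).
  apply: measurable_dist; first exact: (measurableT_comp mx1 measurable_fst).
  exact: (measurableT_comp mx2 measurable_snd).
apply: (@le_trans _ _ (\int[g]_z ((enorm (X1 z.1 - x (k1 z.1)))%:E +
    (enorm (X2 z.2 - x (k2 z.2)))%:E + (enorm (x (k1 z.1) - x (k2 z.2)))%:E))%E).
  apply: ge0_le_integral => //.
  - exact: measurable_dist.
  - by apply: emeasurable_funD => //; exact: emeasurable_funD.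
  - move=> z _; rewrite -!EFinD lee_fin.
    rewrite (le_trans (ler_enorm_dist (x (k1 z.1)) _ _))// -addrA lerD2l.
    apply: le_trans (ler_enorm_dist (x (k2 z.2)) _ _) _.
    by rewrite [leRHS]addrC lerD2l enormB.
rewrite ge0_integralD//; last 2 first.
- by move=> z _; rewrite adde_ge0.
- exact: emeasurable_funD.
rewrite ge0_integralD// leeD2l//.
rewrite (integral_cells2 g mk1' mk2' (fun z => k1M z.1) (fun z => k2M z.2)
  (h := fun i j => enorm (x i - x j))); last by move=> i j; exact: enorm_ge0.
rewrite lee_fin.
apply: le_trans (c'h (fun i => enorm (x i)) _ (fun i j => enorm (x i - x j)) _).
- apply: ler_sum => i _; apply: ler_sum => j _.
  by rewrite mulrC ler_wpM2r ?enorm_ge0// -[leRHS]/(fine (c' i j)%:E) -gc.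
- by move=> i; exact: enorm_ge0.
- by move=> i j; exact: ler_enormB.
Qed.

End wasserstein_upper_bound.

(** * The 1-Wasserstein distance seen through cells *)

Section wasserstein_by_cells.
Context (R : realType) (m : nat).
Local Notation V := 'rV[R]_m.+1.
Implicit Types mu nu : probability V R.

Definition quant_error mu L : \bar R := (\int[mu]_x (enorm (x - quant L x))%:E)%E.

Definition mass mu L i : R := fine (mu (cell L @^-1` [set i])).

(** Inequalities instead of exact marginals: the masses are real numbers, which the row and column
    sums of a rational matrix cannot match in general. *)
Definition subcoupling L (c : nat -> nat -> R) mu nu :=
  (forall i, \sum_(j < 2 ^ L) c i j <= mass mu L i) /\
  (forall j, \sum_(i < 2 ^ L) c i j <= mass nu L j).

(** Quantization at both ends, the plan between centers, and the left-over masses carried through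
    the origin. The measures enter only through integrals of fixed functions, so that measurability
    in a parameter is immediate. *)
Definition cell_cost L (c : nat -> nat -> R) mu nu : \bar R :=
  (quant_error mu L + quant_error nu L +
   (\sum_(i < 2 ^ L) \sum_(j < 2 ^ L)
      c i j * enorm (center L i - center L j : V) +
    \sum_(i < 2 ^ L) (mass mu L i - \sum_(j < 2 ^ L) c i j) *
      enorm (center L i : V) +
    \sum_(j < 2 ^ L) (mass nu L j - \sum_(i < 2 ^ L) c i j) *
      enorm (center L j : V))%:E)%E.

Lemma wasserstein1_le_cost L c mu nu : (forall i j, 0 <= c i j) ->
  subcoupling L c mu nu -> (wasserstein1 mu nu <= cell_cost L c mu nu)%E.
Proof.
move=> c0 [c1 c2].
have W := @wasserstein1_le_cells R m _ _ V V mu nu idfun idfun mu nu (2 ^ L)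
  (cell L) (cell L) (center L) c.
rewrite /cell_cost /quant_error; apply: W => //; try exact: measurable_cell.
- exact: measurable_id.
- exact: measurable_id.
- exact: cell_lt.
- exact: cell_lt.
Qed.

Lemma measurable_quant_dist L :
  measurable_fun setT (fun x : V => (enorm (x - quant L x))%:E).
Proof.
exact: (@measurable_dist R m _ _ idfun (quant L) (@measurable_id _ _ _)
  (measurable_quant L)).
Qed.

Lemma measurable_enorm_id : measurable_fun setT (fun x : V => (enorm x)%:E).
Proof. by apply/measurable_EFinP; exact: measurable_enorm. Qed.

(** Dominated convergence: [dist_quant_small] gives the pointwise limit and [dist_quant_le] the
    majorant. *)
Lemma quant_error_cvg mu : (\int[mu]_x (enorm x)%:E < +oo)%E ->
  forall e : R, 0 < e -> \forall L \near \oo, (quant_error mu L <= e%:E)%E.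
Proof.
move=> mu1 e e0.
have ig : mu.-integrable setT (fun x : V => (2 * enorm x + 1)%:E).
  apply/integrableP; split.
    apply/measurable_EFinP; apply: measurable_funD => //.
    by apply: measurable_funM => //; exact: measurable_enorm.
  under eq_integral => x _ do
    rewrite gee0_abs ?lee_fin ?addr_ge0 ?mulr_ge0 ?enorm_ge0// EFinD EFinM.
  rewrite ge0_integralD//=; last 2 first.
  - by move=> x _; rewrite -EFinM lee_fin mulr_ge0// enorm_ge0.
  - by apply: measurable_funeM; exact: measurable_enorm_id.
  rewrite ge0_integralZl_EFin//; last 2 first.
  - by move=> x _; rewrite lee_fin enorm_ge0.
  - exact: measurable_enorm_id.
  have -> : (\int[mu]__ 1 = 1)%E.
    by rewrite integral_cst// mul1e; exact: probability_setT.
  by rewrite lte_add_pinfty ?ltry// lte_mul_pinfty// lee_fin.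
have [] := @dominated_convergence _ _ _ mu _ measurableT
  (fun L x => (enorm (x - quant L x))%:E) (cst 0%E)
  (fun x : V => (2 * enorm x + 1)%:E) (fun L => measurable_quant_dist L)
  (measurable_cst _) _ ig _.
- apply: aeW => x _; apply/cvg_EFin; first by near=> L.
  apply/cvgrPdist_le => /= eps eps0; rewrite /comp.
  have [L0 L0P] := dist_quant_small m (enorm x) eps0.
  exists L0 => // L /= LL0; rewrite sub0r normrN ger0_norm ?enorm_ge0//.
  exact: L0P.
- apply: aeW => x L _; rewrite gee0_abs ?lee_fin ?enorm_ge0//.
  exact: dist_quant_le.
move=> _ _; rewrite integral0 => /fine_cvgP[fin /cvgrPdist_le/(_ e e0)] cv.
near=> L; have : (`|0 - fine (quant_error mu L)| <= e) by near: L.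
rewrite sub0r normrN => h; rewrite -[quant_error _ _]fineK; last by near: L.
by rewrite lee_fin (le_trans _ h)// ler_norm.
Unshelve. all: by end_near. Qed.

(** A converse to [wasserstein1_le_cost]. A coupling of cost below [e] is read on the pairs of cells
    of a fine level, and its masses [G i j] are rounded down to rationals, which keeps the row and
    column sums below the masses of the cells. *)
Lemma wasserstein1_lt_cost mu nu (e : \bar R) :
  (\int[mu]_x (enorm x)%:E < +oo)%E -> (wasserstein1 mu nu < e)%E ->
  exists L (c : nat -> nat -> rat), [/\ forall i j, 0 <= c i j,
    forall i j, (2 ^ L <= i)%N || (2 ^ L <= j)%N -> c i j = 0,
    subcoupling L (fun i j => ratr (c i j)) mu nu &
    (cell_cost L (fun i j => ratr (c i j)) mu nu < e)%E].
Proof.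
move=> mu1 /ereal_inf_lt[_ [g gmunu <-]] Ke.
set K := (\int[g]_z (enorm (z.1 - z.2))%:E)%E in Ke.
have K0 : (0 <= K)%E by apply: integral_ge0 => z _; rewrite lee_fin enorm_ge0.
have Kfin : K \is a fin_num by rewrite ge0_fin_numE// (lt_le_trans Ke)// leey.
(* Six errors are to come: two quantization errors in the cost itself, two more in replacing the
   points by centers under [g], and the two left-over terms. *)
have [eta eta0 Keta] : exists2 eta : R, 0 < eta & (K + (6 * eta)%:E < e)%E.
  case: e Ke => [e|_|Ke]; last by move: Ke; rewrite ltNge leNye.
    rewrite -(fineK Kfin) lte_fin => Ke; exists ((e - fine K) / 7).
      by rewrite divr_gt0// subr_gt0.
    by rewrite -EFinD lte_fin; lra.
  by exists 1 => //; rewrite lte_add_pinfty ?ltry// -ge0_fin_numE.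
have gm A : measurable A -> mu A = g (fst @^-1` A).
  move=> mA; rewrite -(gmunu A mA).1; congr (g _).
  by apply/seteqP; split => -[s t]//= [].
have gn A : measurable A -> nu A = g (snd @^-1` A).
  move=> mA; rewrite -(gmunu A mA).2; congr (g _).
  by apply/seteqP; split => -[s t]//= [].
have n0 (y : V) : (0 <= (enorm y)%:E)%E by rewrite lee_fin enorm_ge0.
have I1 (h : V -> \bar R) : measurable_fun setT h -> (forall s, 0 <= h s)%E ->
    (\int[mu]_s h s = \int[g]_z h z.1)%E.
  by move=> mh h0; exact: integral_law.
have I2 (h : V -> \bar R) : measurable_fun setT h -> (forall s, 0 <= h s)%E ->
    (\int[nu]_s h s = \int[g]_z h z.2)%E.
  by move=> mh h0; exact: integral_law.
have m12 : measurable_fun setT (fun z : V * V => (enorm (z.1 - z.2))%:E).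
  exact: (measurable_dist measurable_fst measurable_snd).
have m1 : measurable_fun setT (fun z : V * V => (enorm z.1)%:E).
  exact: (measurableT_comp measurable_enorm_id measurable_fst).
have m2 : measurable_fun setT (fun z : V * V => (enorm z.2)%:E).
  exact: (measurableT_comp measurable_enorm_id measurable_snd).
(* The finite cost of [g] transfers the finite first moment from [mu] to [nu]. *)
have nu1 : (\int[nu]_x (enorm x)%:E < +oo)%E.
  rewrite I2//; last exact: measurable_enorm_id.
  apply: (@le_lt_trans _ _ (\int[g]_z ((enorm z.1)%:E + (enorm (z.1 - z.2))%:E))%E).
    apply: ge0_le_integral => //; first exact: emeasurable_funD.
    move=> z _; rewrite -EFinD lee_fin -{1}(subKr z.1 z.2).
    exact: ler_enormB.
  rewrite ge0_integralD// -(I1 (fun x => (enorm x)%:E))//; last exact: measurable_enorm_id.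
  by rewrite lte_add_pinfty// -ge0_fin_numE.
have [L [muL nuL]] : exists L, (quant_error mu L <= eta%:E)%E /\
    (quant_error nu L <= eta%:E)%E.
  near \oo => L; exists L; split; near: L; exact: quant_error_cvg.
set M := (2 ^ L)%N.
pose k1 : V * V -> nat := cell L \o fst.
pose k2 : V * V -> nat := cell L \o snd.
have mk1 i : measurable (k1 @^-1` [set i]).
  rewrite comp_preimage -[X in measurable X]setTI; apply: measurable_fst => //.
  exact: measurable_cell.
have mk2 i : measurable (k2 @^-1` [set i]).
  rewrite comp_preimage -[X in measurable X]setTI; apply: measurable_snd => //.
  exact: measurable_cell.
have k1M z : (k1 z < M)%N by exact: cell_lt.
have k2M z : (k2 z < M)%N by exact: cell_lt.
pose G i j := fine (g (k1 @^-1` [set i] `&` k2 @^-1` [set j])).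
have G0 i j : 0 <= G i j by exact: fine_ge0.
have Gmu i : \sum_(j < M) G i j = mass mu L i.
  rewrite /mass gm; last exact: measurable_cell.
  exact: (congr1 fine (sum_cells g mk2 k2M (mk1 i))).
have Gnu j : \sum_(i < M) G i j = mass nu L j.
  rewrite /mass gn; last exact: measurable_cell.
  rewrite -[RHS](congr1 fine (sum_cells g mk1 k1M (mk2 j))).
  by apply: eq_bigr => i _; rewrite /G setIC.
pose C := \sum_(i < M) enorm (center L i : V).
have C0 : 0 <= C by apply: sumr_ge0 => i _; exact: enorm_ge0.
(* Rounding each entry by at most [delta] leaves at most [M * delta] in a row or column, which costs
   at most [M * delta * C] in all. *)
pose delta := eta / (M%:R * C + 1).
have MC0 : 0 < M%:R * C + 1 by rewrite ltr_wpDl// mulr_ge0.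
have delta0 : 0 < delta by rewrite divr_gt0.
have deltaC : M%:R * delta * C <= eta.
  rewrite /delta mulrAC mulrA -mulrA mulrCA -{2}(mulr1 eta) ler_pM2l//.
  by rewrite ler_pdivrMr// mul1r lerDl.
have [r rP] : {r : nat -> nat -> rat & forall i j,
    [/\ 0 <= r i j, ratr (r i j) <= G i j & G i j - delta <= ratr (r i j)]}.
  have /choice : forall ij : nat * nat, exists r : rat,
      [/\ 0 <= r, ratr r <= G ij.1 ij.2 & G ij.1 ij.2 - delta <= ratr r].
    move=> [i j]; have [Gd|Gd] := leP (G i j) delta.
      by exists 0; rewrite ?rmorph0; split => //; rewrite subr_le0.
    have /rat_in_itvoo[r] : G i j - delta < G i j by rewrite ltrBlDr ltrDl.
    rewrite in_itv/= => /andP[r1 r2]; exists r; split; [|exact/ltW|exact/ltW].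
    by rewrite -(ler0q R) (le_trans _ (ltW r1))// subr_ge0 ltW.
  by move=> [r rP]; exists (fun i j => r (i, j)) => i j; exact: (rP (i, j)).
(* Vanishing outside the range makes the plan recoverable from a finite table of rationals. *)
pose c i j := if (i < M)%N && (j < M)%N then r i j else 0.
have cE (i j : 'I_M) : c i j = r i j by rewrite /c !ltn_ord.
have cG i j : ratr (c i j) <= G i j.
  by rewrite /c; case: ifPn => _; [case: (rP i j)|rewrite rmorph0].
have c0 i j : 0 <= c i j by rewrite /c; case: ifPn => // _; case: (rP i j).
have cR0 i j : 0 <= ratr (c i j) :> R by rewrite ler0q.
exists L, c; split => //.
- move=> i j; rewrite -[(2 ^ L)%N]/M /c => iMjM; case: ifP => // /andP[iM jM].
  by move: iMjM; rewrite leqNgt iM leqNgt jM.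
- split => i; first by rewrite -Gmu; exact: ler_sum.
  by rewrite -Gnu; exact: ler_sum.
pose e12 : \bar R := (\int[g]_z (enorm (quant L z.1 - quant L z.2))%:E)%E.
have e12E : e12 =
    (\sum_(i < M) \sum_(j < M) enorm (center L i - center L j : V) * G i j)%:E.
  apply: (integral_cells2 g mk1 mk2 k1M k2M
    (h := fun i j => enorm (center L i - center L j : V))) => i j.
  exact: enorm_ge0.
have mq1 : measurable_fun setT (fun z : V * V => (enorm (z.1 - quant L z.1))%:E).
  exact: (measurableT_comp (measurable_quant_dist L) measurable_fst).
have mq2 : measurable_fun setT (fun z : V * V => (enorm (z.2 - quant L z.2))%:E).
  exact: (measurableT_comp (measurable_quant_dist L) measurable_snd).
have e12K : (e12 <= quant_error mu L + K + quant_error nu L)%E.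
  rewrite /quant_error I1//; last exact: measurable_quant_dist.
  rewrite [in leRHS]I2//; last exact: measurable_quant_dist.
  rewrite -ge0_integralD// -ge0_integralD//; last 2 first.
  - by move=> z _; rewrite adde_ge0.
  - exact: emeasurable_funD.
  apply: ge0_le_integral => //.
  - apply: measurable_dist.
      exact: (measurableT_comp (measurable_quant L) measurable_fst).
    exact: (measurableT_comp (measurable_quant L) measurable_snd).
  - by apply: emeasurable_funD => //; exact: emeasurable_funD.
  move=> z _; rewrite -!EFinD lee_fin.
  rewrite (le_trans (ler_enorm_dist z.1 _ _))// -addrA enormB lerD2l.
  exact: ler_enorm_dist.
have tail (p : nat -> R) (s : nat -> R) : (forall i : 'I_M, p i - s i <= M%:R * delta) ->
    \sum_(i < M) (p i - s i) * enorm (center L i : V) <= eta.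
  move=> ps; apply: le_trans deltaC; rewrite /C mulr_sumr.
  by apply: ler_sum => i _; rewrite ler_wpM2r// enorm_ge0.
have sumd (f h : 'I_M -> R) : (forall i, f i - delta <= h i) ->
    \sum_(i < M) f i - \sum_(i < M) h i <= M%:R * delta.
  move=> fh; rewrite -sumrB.
  apply: (@le_trans _ _ (\sum_(i < M) delta)).
    by apply: ler_sum => i _; rewrite lerBlDr -lerBlDl.
  by rewrite sumr_const card_ord mulr_natl.
apply: le_lt_trans Keta; rewrite /cell_cost.
apply: (@le_trans _ _ (eta%:E + eta%:E + ((2 * eta)%:E + K + (2 * eta)%:E))%E); last first.
  by rewrite -(fineK Kfin) -!EFinD lee_fin; lra.
apply: leeD; first exact: leeD.
apply: (@le_trans _ _ (e12 + (2 * eta)%:E)%E).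
  rewrite e12E -EFinD lee_fin -addrA mulr2n mulrDl mul1r; apply: lerD; last apply: lerD.
  - by apply: ler_sum => i _; apply: ler_sum => j _;
      rewrite mulrC ler_wpM2l ?enorm_ge0.
  - apply: (tail (mass mu L) (fun i => \sum_(j < M) ratr (c i j))) => i.
    rewrite -Gmu; apply: (sumd (fun j => G i j) (fun j => ratr (c i j))) => j.
    by rewrite cE; case: (rP i j).
  - apply: (tail (mass nu L) (fun j => \sum_(i < M) ratr (c i j))) => j.
    rewrite -Gnu; apply: (sumd (fun i => G i j) (fun i => ratr (c i j))) => i.
    by rewrite cE; case: (rP i j).
rewrite leeD2r//; apply: (le_trans e12K).
rewrite (_ : (2 * eta)%:E = eta%:E + eta%:E)%E; last by rewrite -EFinD; congr EFin; ring.
by rewrite addeAC leeD2r// leeD.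
Unshelve. all: by end_near. Qed.

(** The set where the distance is below [e] is the countable union, over levels and rational plans,
    of the measurable sets where the plan is admissible and costs less than [e]. The moment
    hypothesis bears on the side that will be an empirical measure. *)
Lemma wasserstein1_measurable d (T : measurableType d)
    (mu nu : T -> probability V R) :
  (forall y, \int[mu y]_x (enorm x)%:E < +oo)%E ->
  (forall h : V -> \bar R, measurable_fun setT h -> (forall x, 0 <= h x)%E ->
    measurable_fun setT (fun y => \int[mu y]_x h x)%E) ->
  (forall h : V -> \bar R, measurable_fun setT h -> (forall x, 0 <= h x)%E ->
    measurable_fun setT (fun y => \int[nu y]_x h x)%E) ->
  measurable_fun setT (fun y => wasserstein1 (mu y) (nu y)).
Proof.
move=> mu1 kmu knu.
have mmass (k : T -> probability V R) :
  (forall h : V -> \bar R, measurable_fun setT h -> (forall x, 0 <= h x)%E ->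
    measurable_fun setT (fun y => \int[k y]_x h x)%E) ->
  forall L i, measurable_fun setT (fun y => mass (k y) L i).
  move=> kk L i; apply/measurableT_comp => //.
  rewrite (_ : (fun y => _) =
      (fun y => \int[k y]_x (\1_(cell L @^-1` [set i]) x)%:E)%E).
    apply: kk => [|x]; last by rewrite lee_fin.
    by apply/measurable_EFinP/measurable_indic; exact: measurable_cell.
  by apply/funext => y; rewrite integral_indic ?setIT//; exact: measurable_cell.
(* A countable type of plans: a level and a list of rows, missing entries being read as [0]. *)
pose code := (nat * seq (seq rat))%type.
pose cf (G : seq (seq rat)) i j : rat := nth 0 (nth [::] G i) j.
have mcost L (c : nat -> nat -> R) :
    measurable_fun setT (fun y => cell_cost L c (mu y) (nu y)).
  rewrite /cell_cost; apply: emeasurable_funD; first apply: emeasurable_funD.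
  - by apply: kmu => [|x]; [exact: measurable_quant_dist|rewrite lee_fin enorm_ge0].
  - by apply: knu => [|x]; [exact: measurable_quant_dist|rewrite lee_fin enorm_ge0].
  apply/measurable_EFinP; apply: measurable_funD; first apply: measurable_funD => //.
    apply: measurable_sum => i; apply: measurable_funM => //.
    by apply: measurable_funB => //; exact: mmass.
  apply: measurable_sum => i; apply: measurable_funM => //.
  by apply: measurable_funB => //; exact: mmass.
have msub L (c : nat -> nat -> R) :
    measurable [set y | subcoupling L c (mu y) (nu y)].
  have mle (s : R) (f : T -> R) : measurable_fun setT f ->
      measurable [set y | s <= f y].
    move=> mf; have := mf measurableT _ (@measurable_itv R `[s, +oo[%R).
    by rewrite setTI; congr (measurable _); apply/seteqP; split => y /=;
      rewrite in_itv/= andbT.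
  rewrite (_ : [set _ | _] =
    (\bigcap_i [set y | \sum_(j < 2 ^ L) c i j <= mass (mu y) L i]) `&`
    (\bigcap_j [set y | \sum_(i < 2 ^ L) c i j <= mass (nu y) L j])).
    apply: measurableI; apply: bigcapT_measurable => i; apply: mle; exact: mmass.
  apply/seteqP; split => y /=.
    by move=> [h1 h2]; split => i _ /=.
  by move=> [h1 h2]; split => i; [exact: h1|exact: h2].
apply: (measurability _ (ErealGenInftyO.measurableE R)).
move=> _ [_ [e ->] <-]; rewrite setTI.
rewrite (_ : _ @^-1` _ = \bigcup_(LG in [set LG : code | forall i j, 0 <= cf LG.2 i j])
  ([set y | subcoupling LG.1 (fun i j => ratr (cf LG.2 i j)) (mu y) (nu y)] `&`
   [set y | (cell_cost LG.1 (fun i j => ratr (cf LG.2 i j)) (mu y) (nu y) < e%:E)%E])).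
  rewrite bigcup_mkcond; apply: countable_bigcupT_measurable => [|LG].
    exact: countableP.
  case: ifPn => // _; apply: measurableI; first exact: msub.
  by have := emeasurable_fun_infty_o measurableT (mcost LG.1 (fun i j => ratr (cf LG.2 i j))) e%:E;
    rewrite setTI.
apply/seteqP; split => y /=.
  rewrite in_itv/= => We.
  have [L [c [c0 cM [c1 c2] ce]]] := wasserstein1_lt_cost (mu1 y) We.
  pose G := mkseq (fun i => mkseq (c i) (2 ^ L)) (2 ^ L).
  have GE : cf G = c.
    apply/funext => i; apply/funext => j; rewrite /cf /G.
    have [iL|iL] := ltnP i (2 ^ L)%N; last first.
      by rewrite [nth [::] _ _]nth_default ?size_mkseq// nth_nil cM// iL.
    rewrite nth_mkseq//; have [jL|jL] := ltnP j (2 ^ L)%N; last first.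
      by rewrite nth_default ?size_mkseq// cM// jL orbT.
    by rewrite nth_mkseq.
  by exists (L, G) => /=; rewrite GE.
move=> [[L G] /= c0 [sub ce]]; rewrite in_itv/=; apply: le_lt_trans ce.
by apply: wasserstein1_le_cost => // i j; rewrite ler0q.
Qed.

End wasserstein_by_cells.

(** * Means of near-orthogonal indicators *)

Section limsup.
Context (R : realType).
Implicit Types u v : nat -> R.

Definition lsup u : R := fine (limn_esup (EFin \o u)).

Lemma limn_esup_bounds u (k : nat) (a b : \bar R) :
  (forall n, (k <= n)%N -> (a <= (u n)%:E <= b)%E) ->
  (a <= limn_esup (EFin \o u) <= b)%E.
Proof.
move=> uab; rewrite /limn_esup /limf_esup; apply/andP; split.
  apply: le_ereal_inf_tmp => _ [W [K _ KW] <-].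
  apply: (@le_trans _ _ (u (maxn k K))%:E).
    by have /andP[] := uab _ (leq_maxl k K).
  by apply: ereal_sup_ubound; exists (maxn k K) => //; apply: KW => /=; exact: leq_maxr.
apply: (@le_trans _ _ (ereal_sup ((EFin \o u) @` [set n | (k <= n)%N]))).
  apply: ereal_inf_lbound; exists [set n | (k <= n)%N] => //.
  by exists k.
by apply: ge_ereal_sup => _ [n /= kn <-]; have /andP[] := uab _ kn.
Qed.

Lemma lsup_bounds u (k : nat) (a b : R) :
  (forall n, (k <= n)%N -> a <= u n <= b) -> a <= lsup u <= b.
Proof.
move=> uab; have := @limn_esup_bounds u k a%:E b%:E.
rewrite /lsup; move=> /(_ _)/andP[n kn|]; first by rewrite !lee_fin; exact: uab.
move: (limn_esup _) => [r|//|//] /=; rewrite ?lee_fin => h1 h2.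
by rewrite h1.
Qed.

Lemma le_lsup u v : (forall n, 0 <= u n <= 1) -> (forall n, 0 <= v n <= 1) ->
  (forall n, u n <= v n) -> lsup u <= lsup v.
Proof.
move=> u01 v01 uv; apply: fine_le.
- have /andP[h1 h2] := @limn_esup_bounds u 0%N 0%E 1%E (fun n _ => u01 n).
  by rewrite ge0_fin_numE// (le_lt_trans h2)// ltry.
- have /andP[h1 h2] := @limn_esup_bounds v 0%N 0%E 1%E (fun n _ => v01 n).
  by rewrite ge0_fin_numE// (le_lt_trans h2)// ltry.
apply: le_ereal_inf_tmp => _ [W WF <-].
apply: (@le_trans _ _ (ereal_sup ((EFin \o u) @` W))).
  by apply: ereal_inf_lbound; exists W.
apply: ge_ereal_sup => _ [n Wn <-]; apply: (@le_trans _ _ (v n)%:E).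
  by rewrite lee_fin.
by apply: ereal_sup_ubound; exists n.
Qed.

(* Summable increments make [lsup] the limit; unlike [lim] it is measurable in a
   parameter without any convergence. *)
Lemma lsup_dist u k :
  (`|u k - lsup u|%:E <= \sum_(k <= j <oo) `|u j.+1 - u j|%:E)%E.
Proof.
set S := (X in (_ <= X)%E).
have s0 : (0 <= S)%E by apply: nneseries_ge0 => j _ _; rewrite lee_fin.
have ukn n : (k <= n)%N -> (`|u n - u k|%:E <= S)%E.
  move=> kn; rewrite -telescope_sumr//.
  apply: (@le_trans _ _ (\sum_(k <= j < n) `|u j.+1 - u j|%:E)%E).
    by rewrite sumEFin lee_fin; exact: ler_norm_sum.
  by apply: nneseries_lim_ge => j _ _; rewrite lee_fin.
clearbody S; case: S s0 ukn => [r|_ _|]; [|by rewrite leey|by rewrite leeNy_eq].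
rewrite !lee_fin => r0 ukn; rewrite distrC ler_norml.
have : u k - r <= lsup u <= u k + r.
  apply: (@lsup_bounds _ k) => n kn; rewrite -ler_distl.
  by rewrite -lee_fin; exact: ukn.
by move=> /andP[h1 h2]; apply/andP; split; lra.
Qed.

Lemma measurable_lsup d (T : measurableType d) (u : nat -> T -> R) :
  (forall n, measurable_fun setT (u n)) ->
  measurable_fun setT (fun x => lsup (u ^~ x)).
Proof.
move=> mu; apply: (@measurableT_comp _ _ _ _ _ _ fine) => //.
apply: (measurable_fun_limn_esup (f := fun n x => (u n x)%:E)).
by move=> n; apply/measurable_EFinP.
Qed.

End limsup.

Section near_orthogonal_subsequence.
Context (R : realType) (I : countType) (a : I -> nat -> nat -> R) (C : R).
Hypothesis aC : forall t i j, 0 <= a t i j <= C.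

Lemma ultra_limit (F : set_system nat) (u : nat -> R) : UltraFilter F ->
  (forall n, 0 <= u n <= C) -> exists l, 0 <= l <= C /\
    forall e, 0 < e -> F [set n | `|u n - l| <= e].
Proof.
move=> FU uC.
have [l []] := @segment_compact R 0 C (u @ F) _ (filterS (fun n _ => uC n) filterT).
rewrite /= in_itv/= => l0C clu; exists l; split => // e e0.
have [//|FC] := in_ultra_setVsetC [set n | `|u n - l| <= e] FU.
have /= [] := clu (u @` (~` [set n | `|u n - l| <= e])) (ball l e).
- by apply: filterS FC => n; exists n.
- exact: nbhsx_ballx.
by move=> _ [[n /= nle <-]]; rewrite /ball/= distrC => /ltW.
Qed.

Let eps k : R := 2^-1 ^+ k.

(* The limits along the ultrafilter are iterated: first in the second index of
   [a t], then in the first one. *)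
Lemma near_orthogonal_subsequence : exists (nu : nat -> nat) (alpha : I -> R),
  [/\ subsequence nu, forall t, 0 <= alpha t <= C &
      forall t l k, (pickle t <= l)%N -> (l < k)%N ->
        `|a t (nu l) (nu k) - alpha t| <= 2 * eps l].
Proof.
(* One ultrafilter gives a limit to all these bounded sequences at once; [alpha1 (t, i)] is the
   limit of row [i], and [alpha t] the limit of these row limits. *)
have [F [FU Foo]] := @ultraFilterLemma _ (\oo : set_system nat) _.
have /choice[alpha1 alpha1P] : forall ti : I * nat, exists l, 0 <= l <= C /\
    forall e, 0 < e -> F [set n | `|a ti.1 ti.2 n - l| <= e].
  by move=> [t i]; exact: ultra_limit.
have /choice[alpha alphaP] : forall t, exists l, 0 <= l <= C /\
    forall e, 0 < e -> F [set n | `|alpha1 (t, n) - l| <= e].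
  by move=> t; apply: ultra_limit => n; exact: (alpha1P (t, n)).1.
(* The condition for [n] to be chosen after the indices in [s]. Only the [t] of code at most
   [size s] are concerned, so that finitely many members of [F] are intersected. *)
pose good (s : seq nat) (n : nat) := (forall j, j \in s -> (j < n)%N) /\
  forall t, (pickle t <= size s)%N -> `|alpha1 (t, n) - alpha t| <= eps (size s) /\
    forall j, j \in s -> `|a t j n - alpha1 (t, j)| <= eps (size s).
have eps0 k : 0 < eps k by rewrite exprn_gt0.
have goodP s : exists n, good s n.
  have h1 : F [set n | forall o : 'I_(size s), (nth 0%N s o < n)%N].
    by apply: filter_forall => o; apply: Foo; exists (nth 0%N s o).+1.
  have h2 : F [set n | forall p : 'I_(size s).+1, forall t : I, unpickle p = Some t ->
      `|alpha1 (t, n) - alpha t| <= eps (size s)].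
    apply: filter_forall => p; case: (unpickle p) => [t|]; last first.
      exact: filterS filterT.
    by apply: filterS ((alphaP t).2 _ (eps0 (size s))) => n /= h _ [<-].
  have h3 : F [set n | forall po : 'I_(size s).+1 * 'I_(size s), forall t : I,
      unpickle po.1 = Some t ->
      `|a t (nth 0%N s po.2) n - alpha1 (t, nth 0%N s po.2)| <= eps (size s)].
    apply: filter_forall => -[p o] /=; case: (unpickle p) => [t|]; last first.
      exact: filterS filterT.
    by apply: filterS ((alpha1P (t, nth 0%N s o)).2 _ (eps0 (size s))) => n /= h _ [<-].
  have [n [[n1 n2] n3]] := filter_ex (filterI (filterI h1 h2) h3).
  exists n; split => [j js|t ts].
    have js' : (index j s < size s)%N by rewrite index_mem.
    by have := n1 (Ordinal js'); rewrite /= nth_index.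
  have ts' : (pickle t < (size s).+1)%N by [].
  split; first by apply: (n2 (Ordinal ts')); rewrite /= pickleK.
  move=> j js; have js' : (index j s < size s)%N by rewrite index_mem.
  have := n3 (Ordinal ts', Ordinal js') t; rewrite /= nth_index//; apply.
  by rewrite pickleK.
have /choice[pick pickP] := goodP.
pose prefix := fix prefix k := if k is k'.+1
  then rcons (prefix k') (pick (prefix k')) else [::].
pose nu k := pick (prefix k).
have szp k : size (prefix k) = k by elim: k => //= k IH; rewrite size_rcons IH.
have nup l k : (l < k)%N -> nu l \in prefix k.
  elim: k => // k IH; rewrite ltnS leq_eqVlt mem_rcons inE => /orP[/eqP ->|/IH ->].
    by rewrite eqxx.
  by rewrite orbT.
exists nu, alpha; split.
- by move=> l k lk; apply: (pickP (prefix k)).1; exact: nup.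
- by move=> t; exact: (alphaP t).1.
(* The choice of [nu l] puts its row limit within [eps l] of [alpha t]; the later choice of [nu k]
   puts the entry within [eps k <= eps l] of that row limit. *)
move=> t l k tl lk; have := (pickP (prefix l)).2 t; rewrite szp => /(_ tl)[h1 _].
have := (pickP (prefix k)).2 t; rewrite szp => /(_ (leq_trans tl (ltnW lk)))[_].
move=> /(_ _ (nup _ _ lk)) h2.
have -> : a t (nu l) (nu k) - alpha t = (a t (nu l) (nu k) - alpha1 (t, nu l)) +
   (alpha1 (t, nu l) - alpha t) by ring.
rewrite (le_trans (ler_normD _ _))// mulr2n mulrDl mul1r lerD//.
apply: (le_trans h2); rewrite /eps; apply: ler_wiXn2l => //; last exact: ltnW.
by rewrite invf_le1// ler1n.
Qed.

End near_orthogonal_subsequence.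

(* Coefficients with zero sum annihilate the constant part [al] of the form, and
   what remains is summable off the diagonal. *)
Lemma near_constant_form (R : realType) (b : nat -> nat -> R) (al B : R) (p : nat) :
  0 <= B -> (forall i j, `|b i j - al| <= B) ->
  (forall i j, b i j = b j i) ->
  (forall i j, (p <= i)%N -> (i < j)%N -> `|b i j - al| <= 2 * 2^-1 ^+ i) ->
  forall (N : nat) (c : nat -> R) (k : R), \sum_(i < N) c i = 0 ->
  (forall i, `|c i| <= k) -> \sum_(i < N) `|c i| <= 2 ->
  \sum_(i < N) \sum_(j < N) c i * c j * b i j <= k * (4 * (p%:R * B + 4) + 2 * B).
Proof.
move=> B0 bB bC bp N c k c0 ck c2.
have k0 : 0 <= k by rewrite (le_trans _ (ck 0%N)).
(* The deviation from [al] is at most [w i + w j] off the diagonal: the trivial bound [B] for the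
   first [p] indices, where nothing better is known, and the geometric one afterwards. The sum of
   [w] is at most [p * B + 4]; the diagonal adds [B]. *)
pose w i : R := (if (i < p)%N then B else 0) + 2 * 2^-1 ^+ i.
have w0 i : 0 <= w i by rewrite addr_ge0 ?mulr_ge0 ?exprn_ge0//; case: ifP.
have bw i j : `|b i j - al| <= w i + w j + B * (i == j)%:R.
  wlog ij : i j / (i <= j)%N.
    move=> h; have [|/ltnW ji] := leqP i j; first exact: h.
    by rewrite bC eq_sym (addrC (w i)); exact: h.
  move: ij; rewrite leq_eqVlt => /orP[/eqP ->|ij].
    by rewrite eqxx mulr1 (le_trans (bB _ _))// lerDr addr_ge0.
  rewrite (ltn_eqF ij) mulr0 addr0 -[leLHS]addr0 lerD//.
  have [ip|ip] := ltnP i p; last by rewrite (le_trans (bp _ _ ip ij))// lerDr; case: ifP.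
  by rewrite /w ip (le_trans (bB _ _))// lerDl mulr_ge0// exprn_ge0.
have -> : \sum_(i < N) \sum_(j < N) c i * c j * b i j =
    \sum_(i < N) \sum_(j < N) c i * c j * (b i j - al).
  apply/eqP; rewrite -subr_eq0 -sumrB; apply/eqP.
  transitivity (\sum_(i < N) (c i * al * \sum_(j < N) c j)).
    apply: eq_bigr => i _; rewrite -sumrB mulr_sumr; apply: eq_bigr => j _; ring.
  by rewrite c0 big1// => i _; rewrite mulr0.
apply: (@le_trans _ _ (\sum_(i < N) \sum_(j < N)
    (k * (w i * `|c j|) + k * (w j * `|c i|) + k * (`|c i| * (B * (i == j)%:R))))).
  apply: ler_sum => i _; apply: ler_sum => j _; rewrite (le_trans (ler_norm _))//.
  rewrite !normrM; apply: (@le_trans _ _ (`|c i| * `|c j| * (w i + w j + B * (i == j)%:R))).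
    by rewrite ler_wpM2l// mulr_ge0.
  rewrite (_ : _ * _ = `|c i| * (w i * `|c j|) + `|c j| * (w j * `|c i|) +
    `|c j| * (`|c i| * (B * (i == j)%:R))); last by ring.
  by rewrite !lerD// ler_wpM2r// ?mulr_ge0.
have WB : \sum_(i < N) w i <= p%:R * B + 4.
  rewrite big_split/= lerD//.
    have -> : \sum_(i < N) (if (i < p)%N then B else 0) = (minn N p)%:R * B.
      elim: N {c0 c2} => [|N IH]; first by rewrite big_ord0 min0n mul0r.
      rewrite big_ord_recr/= IH; case: ltnP => Np.
        by rewrite (minn_idPl Np) -natr1 mulrDl mul1r.
      by rewrite (minn_idPr (leqW Np)) addr0.
    by rewrite ler_wpM2r// ler_nat geq_minr.
  rewrite -mulr_sumr.
  have -> : \sum_(i < N) 2^-1 ^+ i = 2 - 2 * 2^-1 ^+ N :> R.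
    elim: N {c0 c2} => [|N IH]; first by rewrite big_ord0 expr0 mulr1 subrr.
    by rewrite big_ord_recr/= IH exprS; field.
  have : 0 <= 2^-1 ^+ N :> R by rewrite exprn_ge0.
  lra.
have W0 : 0 <= \sum_(i < N) w i by apply: sumr_ge0.
have S0 : 0 <= \sum_(i < N) `|c i| by apply: sumr_ge0.
clearbody w.
rewrite (_ : \sum_(i < N) _ = k * ((\sum_(i < N) w i) * (\sum_(j < N) `|c j|) +
  (\sum_(i < N) w i) * (\sum_(j < N) `|c j|) + (\sum_(j < N) `|c j|) * B)).
  rewrite ler_wpM2l//; set W := \sum_(i < N) w i in WB W0 *.
  set S := \sum_(i < N) `|c i| in c2 S0 *; have : W * S <= (p%:R * B + 4) * 2.
    exact: ler_pM.
  have : S * B <= 2 * B by exact: ler_wpM2r.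
  lra.
transitivity (\sum_(i < N) k * (w i * \sum_(j < N) `|c j| +
   `|c i| * \sum_(j < N) w j + `|c i| * B)).
  apply: eq_bigr => i _; rewrite !big_split/= !mulrDr -!mulr_sumr.
  congr (_ + _); last first.
    rewrite (bigD1 i)//= eqxx big1 ?addr0 ?mulr1// => j ij.
    by rewrite eq_sym (negPf ij).
  by rewrite -mulr_suml (mulrC _ `|c i|).
rewrite -mulr_sumr !big_split/= -!mulr_suml [X in _ + X + _]mulrC.
by congr (_ * (_ + _ + _)).
Qed.

Section banach_saks.
Context d (T : measurableType d) (R : realType).
Variable mu : {finite_measure set T -> \bar R}.
Let C := fine (mu setT).

Let CE : mu setT = C%:E.
Proof. by rewrite /C fineK// fin_num_measure. Qed.

Let C0 : 0 <= C. Proof. exact: fine_ge0. Qed.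

Definition comb (F : nat -> set T) (N : nat) (c : nat -> R) (y : T) : R :=
  \sum_(i < N) c i * \1_(F i) y.

Lemma measurable_comb F N c : (forall i, measurable (F i)) ->
  measurable_fun setT (comb F N c).
Proof.
by move=> mF; apply: measurable_sum => i; apply: measurable_funM.
Qed.

Lemma integral_comb_sqr F N c : (forall i, measurable (F i)) ->
  (\int[mu]_y (comb F N c y ^+ 2)%:E = (\sum_(i < N) \sum_(j < N)
     c i * c j * fine (mu (F i `&` F j)))%:E)%E.
Proof.
move=> mF; have mFI i j : measurable (F i `&` F j) by exact: measurableI.
have ii i j : mu.-integrable setT (fun y => (c i * c j)%:E * (\1_(F i `&` F j) y)%:E)%E.
  by apply: integrableZl => //; exact: integrable_indic.
transitivity (\int[mu]_y (\sum_(i < N) \sum_(j < N)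
    (c i * c j)%:E * (\1_(F i `&` F j) y)%:E))%E.
  apply: eq_integral => y _; rewrite expr2 /comb mulr_suml -sumEFin.
  apply: eq_bigr => i _; rewrite mulr_sumr -sumEFin; apply: eq_bigr => j _.
  by rewrite -EFinM; congr EFin; rewrite indicI/=; ring.
rewrite integral_sum//; last by move=> i; exact: integrable_sum.
rewrite -sumEFin; apply: eq_bigr => i _; rewrite integral_sum//.
rewrite -sumEFin; apply: eq_bigr => j _; rewrite integralZl//; last exact: integrable_indic.
by rewrite integral_indic// setIT [RHS]EFinM fineK// fin_num_measure.
Qed.

(** Integrate [|h| <= eta + h ^ 2 / eta]. The free parameter [eta] plays the part of the square root
    in the Cauchy-Schwarz inequality. *)
Lemma integral_comb_le (F : nat -> set T) N (c : nat -> R) (D eta : R) :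
  (forall i, measurable (F i)) ->
  0 < eta ->
  \sum_(i < N) \sum_(j < N) c i * c j * fine (mu (F i `&` F j)) <= D ->
  (\int[mu]_y `|comb F N c y|%:E <= (eta * C + eta^-1 * D)%:E)%E.
Proof.
move=> mF eta0 cD; have mc := measurable_comb N c mF.
have m2 : measurable_fun setT (fun y => (comb F N c y ^+ 2)%:E).
  by apply/measurable_EFinP; exact: measurable_funX.
apply: (@le_trans _ _ (\int[mu]_y (eta%:E + eta^-1%:E * (comb F N c y ^+ 2)%:E)))%E.
  apply: ge0_le_integral => //.
  - by apply/measurable_EFinP; exact: measurableT_comp.
  - by apply: emeasurable_funD => //; exact: measurable_funeM.
  move=> y _; rewrite -EFinM -EFinD lee_fin -(real_normK (num_real (comb F N c y))).
  set h := `|_|; have h0 : 0 <= h by exact: normr_ge0.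
  have -> : eta + eta^-1 * h ^+ 2 = h + ((h - eta) ^+ 2 + h * eta) / eta.
    by field; rewrite gt_eqF.
  by rewrite lerDl divr_ge0 ?addr_ge0 ?sqr_ge0 ?mulr_ge0// ltW.
rewrite ge0_integralD//; last 3 first.
- by move=> y _; rewrite lee_fin ltW.
- by move=> y _; rewrite -EFinM lee_fin mulr_ge0 ?sqr_ge0// invr_ge0 ltW.
- exact: measurable_funeM.
have -> : (\int[mu]__ eta%:E = (eta * C)%:E)%E.
  by rewrite integral_cst// EFinM; congr (_ * _)%E; exact: CE.
rewrite ge0_integralZl_EFin//; last 2 first.
- by move=> y _; rewrite lee_fin sqr_ge0.
- by rewrite invr_ge0 ltW.
rewrite integral_comb_sqr// -!EFinM -EFinD lee_fin lerD2l ler_wpM2l//.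
by rewrite invr_ge0 ltW.
Qed.

End banach_saks.

Section integral_lsup.
Context d (T : measurableType d) (R : realType).
Variable mu : {measure set T -> \bar R}.

Lemma integral_lsup_dist (u : nat -> T -> R) k :
  (forall n, measurable_fun setT (u n)) ->
  (\int[mu]_y `|u k y - lsup (u ^~ y)|%:E <=
   \sum_(j <oo) \int[mu]_y `|u (j + k).+1 y - u (j + k)%N y|%:E)%E.
Proof.
move=> mu_.
have md j : measurable_fun setT (fun y => `|u (j + k).+1 y - u (j + k)%N y|%:E).
  by apply/measurable_EFinP; apply: measurableT_comp => //; exact: measurable_funB.
rewrite -integral_nneseries//.
apply: ge0_le_integral => //.
- apply/measurable_EFinP; apply: measurableT_comp => //.
  by apply: measurable_funB => //; exact: measurable_lsup.
- by apply: ge0_emeasurable_sum.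
- move=> y _; apply: le_trans (lsup_dist (u ^~ y) k) _.
  by rewrite -(nneseries_addn (f := fun j => `|u j.+1 y - u j y|%:E)).
Qed.

Lemma nneseries_geometric_le (D : R) (k : nat) (f : nat -> \bar R) : 0 <= D ->
  (forall j, 0 <= f j)%E -> (forall j, f j <= (D * 2^-1 ^+ j)%:E)%E ->
  (\sum_(j <oo) f (j + k)%N <= (2 * D * 2^-1 ^+ k)%:E)%E.
Proof.
move=> D0 f0 fD.
have geo n : \sum_(0 <= j < n) D * 2^-1 ^+ (j + k) =
    2 * D * 2^-1 ^+ k - 2 * D * 2^-1 ^+ k * 2^-1 ^+ n.
  elim: n => [|n IH]; first by rewrite big_nil expr0 mulr1 subrr.
  by rewrite big_nat_recr//= IH exprS exprD; field.
apply: lime_le; first exact: is_cvg_nneseries.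
near=> n; apply: (@le_trans _ _ (\sum_(0 <= j < n) (D * 2^-1 ^+ (j + k))%:E)%E).
  by apply: lee_sum => j _.
rewrite sumEFin lee_fin geo.
by rewrite gerBl !mulr_ge0 ?exprn_ge0.
Unshelve. all: by end_near. Qed.

End integral_lsup.

Section averages.
Context d (T : measurableType d) (R : realType).
Variable mu : {finite_measure set T -> \bar R}.
Context (I : countType) (E : I -> nat -> set T).
Hypothesis mE : forall t n, measurable (E t n).
Let C := fine (mu setT).

Let C0 : 0 <= C. Proof. exact: fine_ge0. Qed.

Let muC A : measurable A -> fine (mu A) <= C.
Proof.
by move=> mA; rewrite fine_le ?fin_num_measure// le_measure ?inE.
Qed.

(** Moves the weights to the indices they select, so that means along different subsequences become
    combinations of the same sets and can be subtracted. *)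
Lemma comb_reindex (F : nat -> set T) (nu : nat -> nat) N M (w : nat -> R) y :
  (forall n, (n < N)%N -> (nu n < M)%N) ->
  comb (F \o nu) N w y =
  comb F M (fun k => \sum_(n < N) w n * (nu n == k)%:R) y.
Proof.
move=> nuM; rewrite /comb.
under [RHS]eq_bigr do rewrite mulr_suml.
rewrite exchange_big/=; apply: eq_bigr => n _.
rewrite (bigD1 (Ordinal (nuM n (ltn_ord n))))//= eqxx mulr1 big1 ?addr0//.
move=> k /eqP kn; rewrite (_ : (nu n == k) = false) ?mulr0 ?mul0r//.
by apply/eqP => nk; apply: kn; apply/val_inj.
Qed.

Lemma reindex_sum (nu : nat -> nat) N M (w : nat -> R) :
  (forall n, (n < N)%N -> (nu n < M)%N) ->
  \sum_(k < M) \sum_(n < N) w n * (nu n == k)%:R = \sum_(n < N) w n.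
Proof.
move=> nuM; rewrite exchange_big/=; apply: eq_bigr => n _.
rewrite (bigD1 (Ordinal (nuM n (ltn_ord n))))//= eqxx mulr1 big1 ?addr0//.
move=> k /eqP kn; rewrite (_ : (nu n == k) = false) ?mulr0//.
by apply/eqP => nk; apply: kn; apply/val_inj.
Qed.

(** By injectivity at most one term of the sum is nonzero. *)
Lemma reindex_bounds (nu : nat -> nat) N (w : nat -> R) (kappa : R) k :
  injective nu -> (forall n, 0 <= w n <= kappa) ->
  0 <= \sum_(n < N) w n * (nu n == k)%:R <= kappa.
Proof.
move=> nuI wk; have w0 n : 0 <= w n by have /andP[] := wk n.
apply/andP; split; first by apply: sumr_ge0 => n _; rewrite mulr_ge0.
have [[n /= nk]|nk] := pselect (exists n : 'I_N, nu n = k).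
  rewrite (bigD1 n)//= nk eqxx mulr1 big1 ?addr0; first by have /andP[] := wk n.
  move=> n' n'n; rewrite -nk (inj_eq nuI) (_ : _ == _ = false) ?mulr0//.
  exact/negP/negP.
rewrite big1; first by have /andP[] := wk 0%N; exact: le_trans.
move=> n _; rewrite (_ : _ == _ = false) ?mulr0//.
by apply/eqP => nnk; apply: nk; exists n.
Qed.

Lemma sum_inv4 k : \sum_(i < 4 ^ k) 4^-1 ^+ k = 1 :> R.
Proof.
by rewrite sumr_const card_ord -[LHS]mulr_natl natrX -exprMn divff ?expr1n.
Qed.

(* The lengths [4 ^ k] grow fast enough for the distances between consecutive
   means to be summable. *)
Definition cesaro (F : nat -> set T) (k : nat) (y : T) : R :=
  comb F (4 ^ k) (fun=> 4^-1 ^+ k) y.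

Lemma cesaro_bounds F k y : 0 <= cesaro F k y <= 1.
Proof.
have c0 : 0 <= 4^-1 ^+ k :> R by rewrite exprn_ge0.
rewrite /cesaro /comb; apply/andP; split.
  by apply: sumr_ge0 => i _; rewrite mulr_ge0.
apply: (@le_trans _ _ (\sum_(i < 4 ^ k) 4^-1 ^+ k)).
  by apply: ler_sum => i _; rewrite ler_piMr// indicE; case: (_ \in _).
by rewrite sum_inv4.
Qed.

Lemma extraction : exists (nu : nat -> nat) (G : I -> T -> R),
  [/\ subsequence nu, forall t, measurable_fun setT (G t),
      forall t y, G t y = lsup (fun k => cesaro (E t \o nu) k y) &
      forall t (s : regular_summation R) (sigma : nat -> nat),
        subsequence sigma -> forall e : R, 0 < e -> \forall N \near \oo,
        (\int[mu]_y `|comb (E t \o nu \o sigma) N.+1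
           (fun n => s n N / N.+1%:R) y - G t y|%:E <= e%:E)%E].
Proof.
pose a t i j := fine (mu (E t i `&` E t j)).
have aC t i j : 0 <= a t i j <= C.
  by rewrite fine_ge0//= muC//; exact: measurableI.
have [nu [alpha [nuS alphaC nualpha]]] := near_orthogonal_subsequence aC.
pose K (t : I) : R := 4 * ((pickle t)%:R * C + 4) + 2 * C.
have K0 t : 0 <= K t by rewrite addr_ge0 ?mulr_ge0 ?addr_ge0 ?mulr_ge0.
have subI sigma : subsequence sigma -> injective sigma.
  by move=> sS i j ij; have [/sS|/sS|//] := ltngtP i j; rewrite ij ltnn.
have mF t n : measurable ((E t \o nu) n) by exact: mE.
(* The difference of the two means has total weight [0], weights at most [k1 + k2] in absolute
   value, and absolute weights of sum at most [2]. *)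
have dist t (sg1 sg2 : nat -> nat) N1 N2 (w1 w2 : nat -> R) (k1 k2 eta : R) :
    injective sg1 -> injective sg2 ->
    \sum_(n < N1) w1 n = 1 -> \sum_(n < N2) w2 n = 1 ->
    (forall n, 0 <= w1 n <= k1) -> (forall n, 0 <= w2 n <= k2) -> 0 < eta ->
    (\int[mu]_y `|comb (E t \o nu \o sg1) N1 w1 y -
                  comb (E t \o nu \o sg2) N2 w2 y|%:E <=
     (eta * C + eta^-1 * ((k1 + k2) * K t))%:E)%E.
  move=> sI1 sI2 s1 s2 wk1 wk2 eta0.
  pose M := (\max_(n < N1) (sg1 n).+1 + \max_(n < N2) (sg2 n).+1)%N.
  have M1 n : (n < N1)%N -> (sg1 n < M)%N.
    move=> nN; apply: (@leq_trans (\max_(n < N1) (sg1 n).+1)); last exact: leq_addr.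
    exact: (leq_bigmax (Ordinal nN)).
  have M2 n : (n < N2)%N -> (sg2 n < M)%N.
    move=> nN; apply: (@leq_trans (\max_(n < N2) (sg2 n).+1)); last exact: leq_addl.
    exact: (leq_bigmax (Ordinal nN)).
  pose c1 k := \sum_(n < N1) w1 n * (sg1 n == k)%:R.
  pose c2 k := \sum_(n < N2) w2 n * (sg2 n == k)%:R.
  have c1P k : 0 <= c1 k <= k1 by exact: reindex_bounds.
  have c2P k : 0 <= c2 k <= k2 by exact: reindex_bounds.
  under eq_integral => y _.
    rewrite (comb_reindex _ _ _ M1) (comb_reindex _ _ _ M2) -/c1 -/c2.
    rewrite /comb -sumrB.
    under eq_bigr do rewrite -mulrBl.
    over.
  apply: (integral_comb_le (c := fun k => c1 k - c2 k) (mF t) eta0).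
  apply: (@near_constant_form R (fun i j => a t (nu i) (nu j)) (alpha t) C
    (pickle t) _ _ _ _ M (fun k => c1 k - c2 k) (k1 + k2)) => //.
  - move=> i j; have /andP[h1 h2] := aC t (nu i) (nu j).
    by have /andP[h3 h4] := alphaC t; rewrite ler_norml; apply/andP; split; lra.
  - by move=> i j; rewrite /a setIC.
  - by move=> i j; exact: nualpha.
  - by rewrite sumrB !reindex_sum// s1 s2 subrr.
  - move=> i; have /andP[h1 h2] := c1P i; have /andP[h3 h4] := c2P i.
    by rewrite ler_norml; apply/andP; split; lra.
  apply: (@le_trans _ _ (\sum_(i < M) (c1 i + c2 i))).
    apply: ler_sum => i _; have /andP[h1 h2] := c1P i; have /andP[h3 h4] := c2P i.
    by rewrite ler_norml; apply/andP; split; lra.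
  by rewrite big_split/= !reindex_sum// s1 s2 -natr1.
pose A t k y := cesaro (E t \o nu) k y.
have mA t k : measurable_fun setT (A t k) by exact: measurable_comb.
have q0 k : 0 <= 4^-1 ^+ k :> R by rewrite exprn_ge0.
(* Both weights are at most [4^-1 ^+ k], so [eta = 2^-1 ^+ k] balances the two error terms. *)
have AS t k : (\int[mu]_y `|A t k.+1 y - A t k y|%:E <=
    ((C + 2 * K t) * 2^-1 ^+ k)%:E)%E.
  have h0 : 0 < 2^-1 ^+ k :> R by rewrite exprn_gt0.
  apply: (le_trans (@dist t id id (4 ^ k.+1)%N (4 ^ k)%N (fun=> 4^-1 ^+ k.+1)
    (fun=> 4^-1 ^+ k) (4^-1 ^+ k) (4^-1 ^+ k) (2^-1 ^+ k) _ _ _ _ _ _ h0)) => //.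
  - exact: sum_inv4.
  - exact: sum_inv4.
  - move=> _; rewrite q0/= exprS ler_piMl//; lra.
  - by move=> _; rewrite q0/=.
  rewrite lee_fin (_ : 4^-1 = 2^-1 * 2^-1 :> R); last by field.
  rewrite exprMn -exprVn invrK (_ : 2 ^+ k = (2^-1 ^+ k)^-1 :> R); last first.
    by rewrite -exprVn invrK.
  rewrite le_eqVlt; apply/orP; left; apply/eqP; field.
  by rewrite gt_eqF.
pose G t y := lsup (fun k => A t k y).
have AG t k : (\int[mu]_y `|A t k y - G t y|%:E <=
    (2 * (C + 2 * K t) * 2^-1 ^+ k)%:E)%E.
  apply: le_trans (integral_lsup_dist mu k (mA t)) _.
  apply: (@nneseries_geometric_le R (C + 2 * K t) k 
    (fun j => \int[mu]_y `|A t j.+1 y - A t j y|%:E)%E) => //.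
  - by rewrite addr_ge0// mulr_ge0.
  - by move=> j; exact: integral_ge0.
exists nu, G; split => //.
  by move=> t; exact: measurable_lsup.
move=> t s sg sS e e0.
(* The budget: [e / 4] for [eta * C], [e / 8] for the weights of each of the two means, and [e / 4]
   for the distance from the Cesaro mean to [G]; the rest is slack. *)
have e3 : e / 4 + (e / 8 + e / 8) <= 3 * (e / 4) by lra.
have e4 : 2 * (e / 8) <= e / 4 by lra.
have e5 : 3 * (e / 4) + e / 4 <= e by lra.
have [sbar sbarP] := weight_bounded s.
have sbar0 : 0 <= sbar by rewrite (le_trans _ (sbarP 0%N 0%N))// weight_ge0.
pose eta := e / (4 * (C + 1)).
have eta0 : 0 < eta by rewrite divr_gt0// mulr_gt0// ltr_wpDl.
have etaC : eta * C <= e / 4.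
  have C1 : 0 < C + 1 by rewrite ltr_wpDl.
  rewrite (_ : eta * C = e / 4 * (C / (C + 1))); last first.
    by rewrite /eta; field; rewrite gt_eqF.
  apply: ler_piMr; first by rewrite divr_ge0// ltW.
  by rewrite ler_pdivrMr// mul1r lerDl.
pose D := C + 2 * K t.
have D0 : 0 <= D by rewrite addr_ge0// mulr_ge0.
have KD : K t <= D by rewrite /D mulr2n mulrDl mul1r addrA lerDr addr_ge0.
(* The first bound absorbs the factor [eta^-1] in front of the weights, the second serves the
   geometric remainder. The length [4 ^ k] is fixed before [N] grows. *)
pose del := Num.min (e * eta / 8) (e / 8).
have del0 : 0 < del by rewrite lt_min !divr_gt0// mulr_gt0.
have small (x : R) : 0 <= x -> exists n, x / n.+1%:R <= del.
  move=> x0; exists (Num.trunc (x / del)); rewrite ler_pdivrMr// mulrC.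
  by rewrite -ler_pdivrMr// ltW// truncnS_gt.
have [k kP] := small _ D0.
have k2 : D * 2^-1 ^+ k <= del.
  apply: le_trans kP; rewrite ler_wpM2l// exprVn lef_pV2 ?posrE ?exprn_gt0//.
  by rewrite -natrX ler_nat ltn_expl.
have [N0 N0P] := small _ (mulr_ge0 sbar0 (K0 t)).
near=> N.
have NP : sbar / N.+1%:R * K t <= del.
  rewrite mulrAC; apply: le_trans N0P; rewrite ler_wpM2l ?mulr_ge0//.
  rewrite lef_pV2 ?posrE// ler_nat ltnS; near: N; exact: nbhs_infty_ge.
pose w n := s n N / N.+1%:R.
have h := @dist t sg id N.+1 (4 ^ k)%N w (fun=> 4^-1 ^+ k)
  (sbar / N.+1%:R) (4^-1 ^+ k) eta (subI _ sS) (@inj_id _) _ (sum_inv4 k) _ _ eta0.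
have {}h : (\int[mu]_y `|comb (E t \o nu \o sg) N.+1 w y - A t k y|%:E <= (3 * (e / 4))%:E)%E.
  apply: le_trans (h _ _ _) _.
  - by rewrite /w -mulr_suml weight_sum divff.
  - by move=> n; rewrite divr_ge0 ?weight_ge0//= ler_wpM2r ?invr_ge0.
  - by move=> _; rewrite q0/=.
  rewrite lee_fin mulrDl mulrDr.
  have k4 : 4^-1 ^+ k * K t <= del.
    apply: le_trans k2; rewrite mulrC; apply: ler_pM => //.
    by rewrite lerXn2r ?nnegrE// lef_pV2 ?posrE// ler_nat.
  have e1 : eta^-1 * (sbar / N.+1%:R * K t) <= e / 8.
    rewrite mulrC ler_pdivrMr// (le_trans NP)// ge_min.
    by apply/orP; left; rewrite mulrAC.
  have e2 : eta^-1 * (4^-1 ^+ k * K t) <= e / 8.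
    rewrite mulrC ler_pdivrMr// (le_trans k4)// ge_min.
    by apply/orP; left; rewrite mulrAC.
  exact: le_trans (lerD etaC (lerD e1 e2)) e3.
have mw : measurable_fun setT (comb (E t \o nu \o sg) N.+1 w).
  by apply: measurable_comb => i; exact: mE.
have mG : measurable_fun setT (G t) by exact: measurable_lsup.
apply: (@le_trans _ _ (\int[mu]_y (`|comb (E t \o nu \o sg) N.+1 w y - A t k y|%:E +
    `|A t k y - G t y|%:E))%E).
  apply: ge0_le_integral => //.
  - apply/measurable_EFinP; apply: measurableT_comp => //; exact: measurable_funB.
  - apply: emeasurable_funD; apply/measurable_EFinP; apply: measurableT_comp => //;
      exact: measurable_funB.
  - by move=> y _; rewrite -EFinD lee_fin ler_distD.
rewrite ge0_integralD//; last 2 first.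
- apply/measurable_EFinP; apply: measurableT_comp => //; exact: measurable_funB.
- apply/measurable_EFinP; apply: measurableT_comp => //; exact: measurable_funB.
apply: (@le_trans _ _ ((3 * (e / 4))%:E + (e / 4)%:E)%E); last first.
  by rewrite -EFinD lee_fin.
apply: leeD => //; apply: (le_trans (AG t k)); rewrite lee_fin -/D -mulrA.
have : del <= e / 8 by rewrite ge_min lexx orbT.
by move=> /(le_trans k2)/(ler_wpM2l (ler0n R 2))/le_trans; apply.
Unshelve. all: by end_near. Qed.

End averages.

(** The partial plan is diagonal, with entries [min (p i) (q i)]. In each cell it leaves mass on one
    side only, in the amount [|p i - q i|]. *)
Lemma wasserstein1_le_same_cells (R : realType) (m : nat) d1 d2
    (S1 : measurableType d1) (S2 : measurableType d2)
    (P1 : probability S1 R) (P2 : probability S2 R) (X1 : S1 -> 'rV[R]_m.+1)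
    (X2 : S2 -> 'rV[R]_m.+1) (mu nu : probability 'rV[R]_m.+1 R) (M : nat)
    (k1 : S1 -> nat) (k2 : S2 -> nat) (x : nat -> 'rV[R]_m.+1) :
  measurable_fun setT X1 -> measurable_fun setT X2 ->
  (forall A, measurable A -> mu A = P1 (X1 @^-1` A)) ->
  (forall A, measurable A -> nu A = P2 (X2 @^-1` A)) ->
  (forall i, measurable (k1 @^-1` [set i])) ->
  (forall i, measurable (k2 @^-1` [set i])) ->
  (forall s, k1 s < M)%N -> (forall s, k2 s < M)%N ->
  (wasserstein1 mu nu <= \int[P1]_s (enorm (X1 s - x (k1 s)))%:E +
    \int[P2]_s (enorm (X2 s - x (k2 s)))%:E +
    (\sum_(i < M) `|fine (P1 (k1 @^-1` [set (i : nat)])) -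
       fine (P2 (k2 @^-1` [set (i : nat)]))| * enorm (x i))%:E)%E.
Proof.
move=> mX1 mX2 muX nuX mk1 mk2 k1M k2M.
pose p i := fine (P1 (k1 @^-1` [set i])).
pose q i := fine (P2 (k2 @^-1` [set i])).
have p0 i : 0 <= p i by exact: fine_ge0.
have q0 i : 0 <= q i by exact: fine_ge0.
pose c i j := if i == j :> nat then Num.min (p i) (q i) else 0.
have c0 i j : 0 <= c i j by rewrite /c; case: ifP => // _; rewrite le_min p0 q0.
have sumc i : \sum_(j < M) c i j = if (i < M)%N then Num.min (p i) (q i) else 0.
  case: ifP => [iM|/negbT]; last first.
    rewrite -leqNgt => Mi; apply: big1 => j _; rewrite /c ifF//.
    by apply/negbTE; rewrite gtn_eqF// (leq_trans (ltn_ord j)).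
  rewrite (bigD1 (Ordinal iM))//= {1}/c eqxx big1 ?addr0// => j ij.
  by rewrite /c ifF//; apply/negbTE; move: ij; rewrite -val_eqE/= eq_sym.
have sumc' j : \sum_(i < M) c i j = if (j < M)%N then Num.min (p j) (q j) else 0.
  by rewrite -sumc; apply: eq_bigr => i _; rewrite /c eq_sym; case: eqP => // ->.
apply: le_trans (@wasserstein1_le_cells R m _ _ S1 S2 P1 P2 X1 X2 mu nu M k1 k2 x
  c mX1 mX2 muX nuX mk1 mk2 k1M k2M c0 _ _) _.
- by move=> i; rewrite sumc; case: ifP => _; [rewrite ge_min lexx|exact: p0].
- by move=> i; rewrite sumc'; case: ifP => _; [rewrite ge_min lexx orbT|exact: q0].
apply: leeD => //; rewrite lee_fin big1 ?add0r; last first.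
  move=> i _; apply: big1 => j _; rewrite /c; case: eqP => [->|_].
    by rewrite subrr enorm0 mulr0.
  by rewrite mul0r.
rewrite -big_split/=; apply: ler_sum => i _.
rewrite sumc sumc' ltn_ord -mulrDl ler_wpM2r ?enorm_ge0// -/(p i) -/(q i).
by case: (leP (p i) (q i)) => h; rewrite subrr ?addr0 ?add0r ?ler_norm// distrC ler_norm.
Qed.

(** * Empirical measures and quantile functions *)

Section empirical_integral.
Context (R : realType) (m : nat) (s : regular_summation R) (N : nat).
Variable x : nat -> 'rV[R]_m.+1.

Lemma integral_empirical (h : 'rV[R]_m.+1 -> \bar R) :
  measurable_fun setT h -> (forall z, 0 <= h z)%E ->
  (\int[empirical s N x]_z h z =
   \sum_(n < N.+1) (s n N / N.+1%:R)%:E * h (x n))%E.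
Proof.
move=> mh h0; rewrite /empirical ge0_integral_mscale//.
rewrite ge0_integral_measure_sum// ge0_sume_distrr; last first.
  by move=> n _; exact: integral_ge0.
apply: eq_bigr => n _; rewrite ge0_integral_mscale//= integral_dirac//.
by rewrite diracT mul1e muleA -EFinM mulrC.
Qed.

Lemma empirical_cell (A : set 'rV[R]_m.+1) : measurable A ->
  empirical s N x A = (\sum_(n < N.+1) (s n N / N.+1%:R) * \1_A (x n))%:E.
Proof.
move=> mA; rewrite -[LHS]/(empirical s N x A).
have := integral_empirical (h := fun z => (\1_A z)%:E).
rewrite integral_indic// setIT => ->.
- by rewrite -sumEFin; apply: eq_bigr => n _.
- by apply/measurable_EFinP; exact: measurable_indic.
- by move=> z; rewrite lee_fin.
Qed.

End empirical_integral.

Section bin_index.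
Context (R : realType).

(* The index of the interval [[f i, f i.+1[] containing [s]: the quantile function
   of the law with cumulative masses [f]. *)
Definition bin_index (f : nat -> R) (M : nat) (s : R) : nat :=
  (\sum_(1 <= i < M) (f i <= s)%R)%N.

Lemma bin_index_lt (f : nat -> R) M s : (0 < M)%N -> (bin_index f M s < M)%N.
Proof.
case: M => // M _; rewrite ltnS /bin_index.
apply: (@leq_trans (\sum_(1 <= i < M.+1) 1)%N); first by apply: leq_sum => i _; case: (_ <= _).
by rewrite sum_nat_const_nat muln1 subn1.
Qed.

(** By monotonicity the [i] with [f i <= s] form an initial segment, so counting them locates [s].
    This form makes the cumulative masses of the index under the uniform law equal to [f]. *)
Lemma bin_index_ltE (f : nat -> R) M s i :
  (forall j k, (j <= k)%N -> f j <= f k) -> (0 < i < M)%N ->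
  (bin_index f M s < i)%N = (s < f i).
Proof.
move=> fm /andP[i0 iM]; rewrite /bin_index (big_cat_nat _ (n := i.+1))//=.
have [fis|sfi] := leP (f i) s.
  apply/negbTE; rewrite -leqNgt (leq_trans _ (leq_addr _ _))//.
  rewrite (eq_big_nat _ _ (F2 := fun=> 1%N)); last first.
    by move=> j /andP[_ ji]; rewrite (le_trans (fm _ _ _) fis).
  by rewrite sum_nat_const_nat muln1 subn1.
rewrite [X in (_ + X)%N](_ : _ = 0%N); last first.
  rewrite big_nat_cond big1// => j /andP[/andP[ij _] _].
  by rewrite leNgt (lt_le_trans sfi) ?fm// ltnW.
rewrite addn0 big_nat_recr//= leNgt sfi addn0.
apply: (@leq_ltn_trans (\sum_(1 <= j < i) 1)%N); first by apply: leq_sum => j _; case: (_ <= _).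
by rewrite sum_nat_const_nat muln1 subn1 prednK.
Qed.

End bin_index.

Lemma measurable_nat_fiber d (T : measurableType d) (k : T -> nat) :
  (forall i, measurable [set x | (k x < i)%N]) ->
  forall i, measurable (k @^-1` [set i]).
Proof.
move=> mk i; rewrite (_ : _ @^-1` _ =
    [set x | (k x < i.+1)%N] `\` [set x | (k x < i)%N]); first exact: measurableD.
apply/seteqP; split => x /=; first by move=> ->; rewrite ltnSn ltnn.
by move=> [k1 /negP k2]; apply/eqP; rewrite eqn_leq -ltnS k1/= leqNgt.
Qed.

Section uniform.
Context (R : realType).

Definition unif : probability (measurableTypeR R) R := uniform_prob (@ltr01 R).

Lemma unif_lt (a : R) : 0 <= a <= 1 -> unif [set s | s < a] = a%:E.
Proof.
move=> /andP[a0 a1].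
have AE : [set s : R | s < a] = `]-oo, a[%classic.
  by apply/seteqP; split => s /=; rewrite in_itv.
have mA : measurable ([set s | s < a] : set (measurableTypeR R)).
  by rewrite AE; exact: measurable_itv.
rewrite -[LHS]/(unif [set s | s < a]) -[in LHS](setIT [set s | s < a]).
rewrite -(integral_indic unif measurableT mA).
rewrite integral_uniform//; last by apply/measurable_EFinP; exact: measurable_indic.
rewrite subr0 invr1 mul1e integral_indic// AE.
rewrite (_ : _ `&` _ = `[0, a[%classic).
  rewrite -[LHS]/(lebesgue_measure `[0, a[%classic) lebesgue_measure_itv/=.
  rewrite lte_fin oppr0 adde0.
  by case: ltgtP a0 => // <-.
apply/seteqP; split => s /=; rewrite !in_itv/=.
  by move=> [-> /andP[->]].
by move=> /andP[-> sa]; split => //=; rewrite (le_trans (ltW sa)).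
Qed.

End uniform.

Lemma measurable_bin_index d (T : measurableType d) (R : realType)
    (f : nat -> T -> R) (t : T -> R) M : (0 < M)%N ->
  (forall i, measurable_fun setT (f i)) -> measurable_fun setT t ->
  (forall x j k, (j <= k)%N -> f j x <= f k x) ->
  forall i, measurable ((fun x => bin_index (f ^~ x) M (t x)) @^-1` [set i]).
Proof.
move=> M0 mf mt fm; apply: measurable_nat_fiber => i.
have [->|i0] := posnP i.
  by rewrite (_ : [set _ | _] = set0)//; apply/seteqP; split.
have [Mi|iM] := leqP M i.
  rewrite (_ : [set _ | _] = setT)//; apply/seteqP; split => // x _ /=.
  exact: leq_trans (bin_index_lt _ _ M0) Mi.
rewrite (_ : [set _ | _] = [set x | t x < f i x]); last first.
  by apply/seteqP; split => x /=; rewrite bin_index_ltE ?i0//; exact: fm.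
have := measurable_fun_ltr mt (mf i) measurableT (_ : measurable [set true]).
by rewrite setTI; apply.
Qed.

Lemma cell_div (R : realType) (m : nat) L L' (x : 'rV[R]_m.+1) : (L <= L')%N ->
  cell L x = (cell L' x %/ 2 ^ (L' - L))%N.
Proof.
move=> /subnKC <-; rewrite addKn; elim: (L' - L)%N => [|k IH].
  by rewrite addn0 expn0 divn1.
rewrite addnS expnS divnMA IH; congr (_ %/ _)%N; rewrite /= divn2 halfD odd_double.
by rewrite doubleK andbF add0n; case: (test _ _).
Qed.

Lemma eq_nat_lt (a b : nat) : (forall i, (a < i)%N = (b < i)%N) -> a = b.
Proof.
move=> ab; apply/eqP; rewrite eqn_leq -ltnS ab ltnS leqnn/=.
by rewrite -ltnS -ab ltnS.
Qed.

(** The counterpart of [cell_div] for quantiles: the coarse cumulative masses are the fine ones at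
    multiples of [k], so the fine intervals subdivide the coarse ones in order. *)
Lemma bin_index_div (R : realType) (f g : nat -> R) (M k : nat) (s : R) :
  (0 < M)%N -> (0 < k)%N -> (forall i j, (i <= j)%N -> f i <= f j) ->
  (forall i j, (i <= j)%N -> g i <= g j) -> (forall i, f i = g (i * k)%N) ->
  bin_index f M s = (bin_index g (M * k) s %/ k)%N.
Proof.
move=> M0 k0 fm gm fg; have Mk0 : (0 < M * k)%N by rewrite muln_gt0 M0.
apply: eq_nat_lt => i; rewrite ltn_divLR//.
have [->|i0] := posnP i; first by rewrite mul0n !ltn0.
have [Mi|iM] := leqP M i.
  rewrite (leq_trans (bin_index_lt _ _ M0) Mi).
  by rewrite (leq_trans (bin_index_lt _ _ Mk0))// leq_mul2r Mi orbT.
rewrite !bin_index_ltE ?i0 ?fg//.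
by rewrite muln_gt0 i0 k0/= ltn_pmul2r.
Qed.

Lemma enorm_lsup_dist (R : realType) (m : nat) (x : nat -> 'rV[R]_m.+1) k :
  ((enorm (x k - \row_i lsup (fun j => x j ord0 i)))%:E <=
   m.+1%:R%:E * \sum_(j <oo) (enorm (x (j + k).+1 - x (j + k)%N))%:E)%E.
Proof.
set S := (X in (_ * X)%E).
have coord i : (`|x k ord0 i - lsup (fun j => x j ord0 i)|%:E <= S)%E.
  apply: le_trans (lsup_dist _ k) _.
  rewrite -(nneseries_addn (f := fun j => `|x j.+1 ord0 i - x j ord0 i|%:E))//.
  apply: lee_nneseries => // j _; rewrite lee_fin.
  by have := coord_le_enorm (x (j + k).+1 - x (j + k)%N) i; rewrite !mxE.
have S0 : (0 <= S)%E by apply: nneseries_ge0 => j _ _; rewrite lee_fin enorm_ge0.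
clearbody S; case: S S0 coord => [r|_ _|]; last by rewrite leeNy_eq.
  rewrite lee_fin => r0 coord; rewrite -EFinM lee_fin mulrC.
  apply: enorm_le_coord => // i; rewrite !mxE -lee_fin; exact: coord.
by rewrite gt0_muley ?leey// lte_fin.
Qed.

Lemma integral_cells d (T : measurableType d) (R : realType)
    (P : probability T R) (M : nat) (k : T -> nat) (h : nat -> R) :
  (forall i, measurable (k @^-1` [set i])) -> (forall x, k x < M)%N ->
  (forall i, 0 <= h i) ->
  (\int[P]_x (h (k x))%:E =
   (\sum_(i < M) h i * fine (P (k @^-1` [set (i : nat)])))%:E)%E.
Proof.
move=> mk kM h0.
have mk2 i : measurable ((fun _ : T => 0%N) @^-1` [set i]).
  by rewrite preimage_cst; case: ifP.
rewrite (integral_cells2 P (M2 := 1) mk mk2 kM (fun=> ltnSn 0) (h := fun i _ => h i))//.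
congr EFin; apply: eq_bigr => i _; rewrite big_ord_recl big_ord0 addr0 preimage_cst.
by rewrite ifT ?setIT// inE.
Qed.

(** * The limit measure *)

(** A concrete method along which the bounds known for empirical measures are passed to the limit
    masses. *)
Definition cesaro_summation (R : realType) : regular_summation R.
Proof.
apply: (@RegularSummation R (fun n N => (n <= N)%N%:R)).
- by [].
- by exists 1 => n N; rewrite lern1 leq_b1.
- by move=> n N; rewrite ltnNge => /negbTE ->.
move=> N; rewrite (eq_bigr (fun=> 1)); last by move=> i _; rewrite -ltnS ltn_ord.
by rewrite sumr_const card_ord.
Defined.

Section limit_measure.
Context d (T : measurableType d) (R : realType) (m : nat).
Variable mu : {finite_measure set T -> \bar R}.
Local Notation V := 'rV[R]_m.+1.
Variables (u : nat -> T -> V) (G : nat -> nat -> T -> R).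
Hypothesis mu_ : forall n, measurable_fun setT (u n).
Hypothesis mG : forall L i, measurable_fun setT (G L i).
Hypothesis G0 : forall L y, G L 0%N y = 0.
Hypothesis G1 : forall L y, G L (2 ^ L)%N y = 1.
Hypothesis Gm : forall L y i j, (i <= j)%N -> G L i y <= G L j y.
Hypothesis Gd : forall L L' i y, (L <= L')%N ->
  G L i y = G L' (i * 2 ^ (L' - L))%N y.
Hypothesis Gcvg : forall L i (s : regular_summation R) (sigma : nat -> nat),
  subsequence sigma -> forall e : R, 0 < e -> \forall N \near \oo,
  (\int[mu]_y `|comb (fun n => [set y | (cell L (u (sigma n) y) < i)%N]) N.+1
      (fun n => s n N / N.+1%:R) y - G L i y|%:E <= e%:E)%E.
Hypothesis quantu : forall e : R, 0 < e -> exists L0, forall L, (L0 <= L)%N ->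
  forall n, (\int[mu]_y (enorm (u n y - quant L (u n y)))%:E <= e%:E)%E.

Let pow_gt0 L : (0 < 2 ^ L)%N. Proof. by rewrite expn_gt0. Qed.

(** A random cell of level [L] with the limit masses at [y]. The same [s] serves all levels, so that
    the random cells are nested. *)
Let idx L (y : T) (s : R) : nat := bin_index (fun i => G L i y) (2 ^ L) s.

Let idx_lt L y s : (idx L y s < 2 ^ L)%N.
Proof. exact: bin_index_lt. Qed.

Let idx_div L L' y s : (L <= L')%N -> idx L y s = (idx L' y s %/ 2 ^ (L' - L))%N.
Proof.
move=> LL'; have E : (2 ^ L * 2 ^ (L' - L) = 2 ^ L')%N by rewrite -expnD subnKC.
rewrite /idx -E; apply: bin_index_div => //; [exact: Gm|exact: Gm|].
by move=> i; exact: Gd.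
Qed.

Let measurable_idx2 L i : measurable
  ((fun z : T * measurableTypeR R => idx L z.1 z.2) @^-1` [set i]).
Proof.
apply: (@measurable_bin_index _ _ _ (fun i (z : T * measurableTypeR R) => G L i z.1) snd) => //.
- by move=> j; exact: (measurableT_comp (mG L j) measurable_fst).
- by move=> z j k; exact: Gm.
Qed.

Let measurable_idx L y i : measurable ((idx L y : measurableTypeR R -> nat) @^-1` [set i]).
Proof.
apply: (@measurable_bin_index _ _ _ (fun i (s : measurableTypeR R) => G L i y) id) => //.
by move=> z j k; exact: Gm.
Qed.

Let idx_mass L y i : (i < 2 ^ L)%N ->
  fine (unif R (idx L y @^-1` [set i])) = G L i.+1 y - G L i y.
Proof.
move=> iL; have mlt j : (j <= 2 ^ L)%N ->
    measurable ([set s | idx L y s < j]%N : set (measurableTypeR R)) /\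
    unif R [set s | idx L y s < j]%N = (G L j y)%:E.
  move=> jL; have [->|j0] := posnP j.
    rewrite (_ : [set _ | _] = set0); last by apply/seteqP; split.
    by rewrite measure0 G0.
  have [jL'|] := ltnP j (2 ^ L)%N; last first.
    move=> Lj; have -> : j = (2 ^ L)%N by apply/eqP; rewrite eqn_leq jL.
    rewrite (_ : [set _ | _] = setT).
      by rewrite G1; split => //; exact: probability_setT.
    by apply/seteqP; split => s _ //=; exact: idx_lt.
  rewrite (_ : [set _ | _] = [set s | s < G L j y]); last first.
    apply/seteqP; split => s /=; rewrite /idx bin_index_ltE ?j0//; exact: Gm.
  split; last by rewrite unif_lt// -{1}(G0 L y) -(G1 L y) !Gm.
  rewrite (_ : [set _ | _] = `]-oo, G L j y[%classic); first exact: measurable_itv.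
  by apply/seteqP; split => s /=; rewrite in_itv.
have [m1 u1] := mlt i (ltnW iL); have [m2 u2] := mlt i.+1 iL.
rewrite (_ : _ @^-1` _ = [set s | idx L y s < i.+1]%N `\` [set s | idx L y s < i]%N).
  rewrite measureD//; last by have := ltry (G L i.+1 y); rewrite -u2.
  rewrite setIidr; last by move=> s /=; exact: ltnW.
  exact: (congr1 fine (congr2 (fun a b => a - b)%E u2 u1)).
apply/seteqP; split => s /=; first by move=> ->; rewrite ltnSn ltnn.
by move=> [k1 /negP k2]; apply/eqP; rewrite eqn_leq -ltnS k1/= leqNgt.
Qed.

Let emp s N (sigma : nat -> nat) y : probability V R :=
  empirical s N (fun n => u (sigma n) y).

Let integral_emp_le s N sigma (h : V -> \bar R) (e : R) : measurable_fun setT h ->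
  (forall z, 0 <= h z)%E -> (forall n, \int[mu]_y h (u n y) <= e%:E)%E ->
  (\int[mu]_y \int[emp s N sigma y]_x h x <= e%:E)%E.
Proof.
move=> mh h0 he.
have mhu n : measurable_fun setT (fun y => h (u n y)) by exact: measurableT_comp.
have s0 n : (0 <= (s n N / N.+1%:R)%:E)%E by rewrite lee_fin divr_ge0// weight_ge0.
under eq_integral do rewrite integral_empirical//.
rewrite ge0_integral_sum//; last 2 first.
- by move=> n; exact: measurable_funeM.
- by move=> n y _; exact: mule_ge0.
apply: (@le_trans _ _ (\sum_(n < N.+1) (s n N / N.+1%:R)%:E * e%:E)%E).
  apply: lee_sum => n _; rewrite ge0_integralZl//; exact: lee_wpmul2l.
rewrite -ge0_sume_distrl; last by move=> n _.
by rewrite sumEFin -mulr_suml weight_sum divff// mul1e.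
Qed.

Let measurable_emp s N sigma (h : V -> \bar R) : measurable_fun setT h ->
  (forall z, 0 <= h z)%E ->
  measurable_fun setT (fun y => \int[emp s N sigma y]_x h x)%E.
Proof.
move=> mh h0; under eq_fun do rewrite integral_empirical//.
apply: emeasurable_sum => n; apply: measurable_funeM; exact: measurableT_comp.
Qed.

Let p s N sigma L i y := fine (emp s N sigma y (cell L @^-1` [set i])).
Let q L i y := G L i.+1 y - G L i y.

Let mset L i n : measurable [set y | (cell L (u n y) < i)%N].
Proof. by have := mu_ n measurableT (measurable_cell_lt L i); rewrite setTI. Qed.

(** Convergence is known for the cumulative means; the masses of the cells are their increments. *)
Let pE s N sigma L i y : p s N sigma L i y =
  comb (fun n => [set y | (cell L (u (sigma n) y) < i.+1)%N]) N.+1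
    (fun n => s n N / N.+1%:R) y -
  comb (fun n => [set y | (cell L (u (sigma n) y) < i)%N]) N.+1
    (fun n => s n N / N.+1%:R) y.
Proof.
transitivity (fine (empirical s N (fun n => u (sigma n) y) (cell L @^-1` [set i]))) => //.
rewrite empirical_cell; last exact: measurable_cell.
rewrite /comb -sumrB/=; apply: eq_bigr => n _; rewrite -mulrBr; congr (_ * _).
have memE j : (y \in [set y0 | (cell L (u (sigma n) y0) < j)%N]) =
    (cell L (u (sigma n) y) < j)%N by apply/idP/idP => [|h]; rewrite inE.
rewrite !indicE !memE ltnS.
rewrite (_ : (_ \in _) = (cell L (u (sigma n) y) == i)); last first.
  by apply/idP/eqP => [|h]; rewrite inE.
by case: ltngtP => _; rewrite ?subrr ?subr0.
Qed.

Let measurable_comb_cell s N sigma L i : measurable_fun setT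
  (comb (fun n => [set y | (cell L (u (sigma n) y) < i)%N]) N.+1
    (fun n => s n N / N.+1%:R : R)).
Proof. by apply: measurable_comb => n; exact: mset. Qed.

Let measurable_p s N sigma L i : measurable_fun setT (p s N sigma L i).
Proof.
rewrite (funext (pE s N sigma L i)); apply: measurable_funB; exact: measurable_comb_cell.
Qed.

Let measurable_q L i : measurable_fun setT (q L i).
Proof. exact: measurable_funB. Qed.

Let measurable_pq s N sigma L i :
  measurable_fun setT (fun y => `|p s N sigma L i y - q L i y|%:E).
Proof. by apply/measurable_EFinP; apply: measurableT_comp => //; exact: measurable_funB. Qed.

Let cells_cvg s sigma L i (e : R) : subsequence sigma -> 0 < e ->
  \forall N \near \oo, (\int[mu]_y `|p s N sigma L i y - q L i y|%:E <= e%:E)%E.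
Proof.
move=> sS e0; have e2 : 0 < e / 2 by rewrite divr_gt0.
near=> N.
have h1 : (\int[mu]_y `|comb (fun n => [set y | (cell L (u (sigma n) y) < i.+1)%N]) N.+1
      (fun n => s n N / N.+1%:R) y - G L i.+1 y|%:E <= (e / 2)%:E)%E.
  by near: N; exact: Gcvg.
have h2 : (\int[mu]_y `|comb (fun n => [set y | (cell L (u (sigma n) y) < i)%N]) N.+1
      (fun n => s n N / N.+1%:R) y - G L i y|%:E <= (e / 2)%:E)%E.
  by near: N; exact: Gcvg.
rewrite (splitr e) EFinD; apply: le_trans (leeD h1 h2).
have mc j : measurable_fun setT (fun y =>
    `|comb (fun n => [set y | (cell L (u (sigma n) y) < j)%N]) N.+1
      (fun n => s n N / N.+1%:R) y - G L j y|%:E).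
  apply/measurable_EFinP; apply: measurableT_comp => //.
  by apply: measurable_funB => //; exact: measurable_comb_cell.
rewrite -ge0_integralD//; apply: ge0_le_integral => //.
- exact: emeasurable_funD.
move=> y _; rewrite -EFinD lee_fin pE /q.
set a := comb _ _ _ _; set b := comb _ _ _ _.
rewrite (_ : _ - _ = (a - G L i.+1 y) - (b - G L i y)); last by ring.
exact: ler_normB.
Unshelve. all: by end_near. Qed.

Let lev : {lev : nat -> nat | (forall k, lev k <= lev k.+1)%N /\
  forall k n, (\int[mu]_y (enorm (u n y - quant (lev k) (u n y)))%:E <=
     (2^-1 ^+ k)%:E)%E}.
Proof.
have h k : exists L0, forall L, (L0 <= L)%N ->
    forall n, (\int[mu]_y (enorm (u n y - quant L (u n y)))%:E <= (2^-1 ^+ k : R)%:E)%E.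
  by apply: quantu; rewrite exprn_gt0.
have [L0 L0P] := choice h.
(* Partial sums, in place of [L0 k] alone, make the levels nondecreasing. *)
exists (fun k => \sum_(j < k.+1) L0 j)%N; split => k.
  by rewrite [leqRHS]big_ord_recr/= leq_addr.
by apply: L0P; rewrite big_ord_recr/= leq_addl.
Qed.

Let lv := sval lev.
Let lvS k : (lv k <= lv k.+1)%N. Proof. exact: (svalP lev).1. Qed.
Let lvP k n : (\int[mu]_y (enorm (u n y - quant (lv k) (u n y)))%:E <=
  (2^-1 ^+ k)%:E)%E.
Proof. exact: (svalP lev).2. Qed.

(** The levels [lv k] are those at which the quantization error is at most [2 ^ -k] uniformly in
    [n], so that the increments of [X] will be summable in mean. The limit [Xlim] is a
    coordinatewise [lsup], hence defined and measurable everywhere. *)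
Let X k y s : V := center (lv k) (idx (lv k) y s).
Let Xlim y s : V := \row_i lsup (fun k => X k y s ord0 i).

Let measurable_X2 k :
  measurable_fun setT (fun z : T * measurableTypeR R => X k z.1 z.2).
Proof.
exact: (measurable_comp_cell (fun i => center (lv k) i : V) (measurable_idx2 (lv k))).
Qed.

Let measurable_Xlim2 :
  measurable_fun setT (fun z : T * measurableTypeR R => Xlim z.1 z.2).
Proof.
apply: measurable_fun_rV => i; under eq_fun do rewrite mxE.
apply: (measurable_lsup (u := fun k (z : T * measurableTypeR R) => X k z.1 z.2 ord0 i)) => k.
exact: measurable_fun_coord.
Qed.

Let measurable_X k y : measurable_fun setT (X k y : measurableTypeR R -> V).
Proof.
exact: (measurable_comp_cell (fun i => center (lv k) i : V) (measurable_idx (lv k) y)).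
Qed.

Let measurable_Xlim y : measurable_fun setT (Xlim y : measurableTypeR R -> V).
Proof.
apply: measurable_fun_rV => i; under eq_fun do rewrite mxE.
apply: (measurable_lsup (u := fun k (s : measurableTypeR R) => X k y s ord0 i)) => k.
exact: measurable_fun_coord.
Qed.

Let D k y : \bar R := (\int[unif R]_s (enorm (X k.+1 y s - X k y s))%:E)%E.

Let dd k i : R := enorm (center (lv k.+1) i -
  center (lv k) (i %/ 2 ^ (lv k.+1 - lv k)) : V).

(** The index of level [lv k] is a function of that of level [lv k.+1], so the increment depends on
    one random cell, and its mean is linear in finitely many limit masses. *)
Let DE k y : D k y = (\sum_(i < 2 ^ lv k.+1) dd k i * q (lv k.+1) i y)%:E.
Proof.
rewrite /D /X; under eq_integral do rewrite (idx_div _ _ (lvS k)).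
rewrite (integral_cells _ (measurable_idx (lv k.+1) y) (idx_lt _ y) (h := dd k)).
  by congr EFin; apply: eq_bigr => i _; rewrite idx_mass.
by move=> i; exact: enorm_ge0.
Qed.

Let measurable_D k : measurable_fun setT (D k).
Proof.
rewrite (funext (DE k)); apply/measurable_EFinP; apply: measurable_sum => i.
exact: measurable_funM.
Qed.

Let D0 k y : (0 <= D k y)%E.
Proof. by apply: integral_ge0 => s _; rewrite lee_fin enorm_ge0. Qed.

(** With empirical masses in place of [q], the same linear expression averages the distances between
    the quantizations of [u n] at levels [lv k] and [lv k.+1], hence is at most
    [2 ^ -(k+1) + 2 ^ -k] after integration. The bound survives the convergence of the finitely many
    masses. *)
Let integral_D k : (\int[mu]_y D k y <= (2 * 2^-1 ^+ k)%:E)%E.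
Proof.
apply/lee_addgt0Pr => e e0.
pose M := (2 ^ lv k.+1)%N; pose B := \sum_(i < M) dd k i.
have dd0 i : 0 <= dd k i by exact: enorm_ge0.
have B0 : 0 <= B by exact: sumr_ge0.
pose cs := cesaro_summation R.
have e1 : 0 < e / (B + 1) by rewrite divr_gt0// ltr_wpDl.
near \oo => N.
pose h (z : V) : \bar R := (dd k (cell (lv k.+1) z))%:E.
have mh : measurable_fun setT h.
  apply/measurable_EFinP.
  exact: (measurable_comp_cell (dd k) (measurable_cell (lv k.+1))).
have h0 z : (0 <= h z)%E by rewrite lee_fin.
have hE z : h z = (enorm (quant (lv k.+1) z - quant (lv k) z))%:E.
  by rewrite /h /dd /quant (cell_div z (lvS k)).
have hu n : (\int[mu]_y h (u n y) <= (2 * 2^-1 ^+ k)%:E)%E.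
  rewrite mulr2n mulrDl mul1r EFinD.
  have mq j : measurable_fun setT (fun y => (enorm (u n y - quant (lv j) (u n y)))%:E).
    by apply: measurable_dist => //; apply: measurableT_comp => //; exact: measurable_quant.
  apply: (@le_trans _ _ (\int[mu]_y ((enorm (u n y - quant (lv k.+1) (u n y)))%:E +
      (enorm (u n y - quant (lv k) (u n y)))%:E))%E).
    apply: ge0_le_integral => //.
    - exact: measurableT_comp.
    - exact: emeasurable_funD.
    by move=> y _; rewrite hE -EFinD lee_fin (enormB (u n y) (quant (lv k.+1) _)) ler_enorm_dist.
  rewrite ge0_integralD//; first last.
  - by move=> y _; rewrite lee_fin enorm_ge0.
  - by move=> y _; rewrite lee_fin enorm_ge0.
  apply: leeD; last exact: lvP.
  apply: (le_trans (lvP k.+1 n)); rewrite lee_fin exprS ler_piMl ?exprn_ge0//; lra.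
have hp y : (\int[emp cs N id y]_x h x)%E = (\sum_(i < M) dd k i * p cs N id (lv k.+1) i y)%:E.
  exact: (integral_cells _ (measurable_cell (lv k.+1)) (@cell_lt _ _ _)).
apply: (@le_trans _ _ (\int[mu]_y (\int[emp cs N id y]_x h x +
   \sum_(i < M) (dd k i)%:E * `|p cs N id (lv k.+1) i y - q (lv k.+1) i y|%:E))%E).
  apply: ge0_le_integral => //.
  - apply: emeasurable_funD; first exact: measurable_emp.
    apply: emeasurable_sum => i; exact: measurable_funeM.
  move=> y _; rewrite DE hp.
  rewrite (eq_bigr (fun i : 'I_M => (dd k i * `|p cs N id (lv k.+1) i y - q (lv k.+1) i y|)%:E))//.
  rewrite sumEFin -EFinD lee_fin -big_split/=; apply: ler_sum => i _.
  rewrite -mulrDr ler_wpM2l// -lerBlDl distrC ler_norm//.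
rewrite ge0_integralD//; last 4 first.
- by move=> y _; exact: integral_ge0.
- exact: measurable_emp.
- by move=> y _; apply: sume_ge0 => i _; rewrite mule_ge0 ?lee_fin.
- by apply: emeasurable_sum => i; exact: measurable_funeM.
apply: leeD; first exact: integral_emp_le.
rewrite ge0_integral_sum//; last 2 first.
- by move=> i; exact: measurable_funeM.
- by move=> i y _; rewrite mule_ge0 ?lee_fin.
apply: (@le_trans _ _ (\sum_(i < M) (dd k i)%:E * (e / (B + 1))%:E)%E).
  apply: lee_sum => i _; rewrite ge0_integralZl//; last by rewrite lee_fin.
  apply: lee_wpmul2l; first by rewrite lee_fin.
  have : forall i : 'I_M,
      (\int[mu]_y `|p cs N id (lv k.+1) i y - q (lv k.+1) i y|%:E <= (e / (B + 1))%:E)%E.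
    near: N; apply: filter_forall => j; exact: cells_cvg.
  exact.
rewrite (eq_bigr (fun i : 'I_M => (dd k i * (e / (B + 1)))%:E))//.
rewrite sumEFin lee_fin -mulr_suml -/B mulrCA ler_piMr ?(ltW e0)//.
by rewrite ler_pdivrMr ?mul1r ?lerDl// ltr_wpDl.
Unshelve. all: by end_near. Qed.

Let tail k y : \bar R := (\int[unif R]_s (enorm (Xlim y s - X k y s))%:E)%E.

Let tail_le k y : (tail k y <= m.+1%:R%:E * \sum_(j <oo) D (j + k)%N y)%E.
Proof.
have mX j : measurable_fun setT (fun s : measurableTypeR R =>
    (enorm (X (j + k).+1 y s - X (j + k)%N y s))%:E).
  exact: measurable_dist.
have X0 j s : (0 <= (enorm (X (j + k).+1 y s - X (j + k)%N y s))%:E)%E.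
  by rewrite lee_fin enorm_ge0.
rewrite /D -integral_nneseries// -ge0_integralZl//; last 2 first.
- exact: ge0_emeasurable_sum.
- by move=> s _; exact: nneseries_ge0.
apply: ge0_le_integral => //.
- by move=> s _; rewrite lee_fin enorm_ge0.
- exact: measurable_dist.
- by apply: measurable_funeM; exact: ge0_emeasurable_sum.
by move=> s _; rewrite enormB; exact: (enorm_lsup_dist (fun k => X k y s) k).
Qed.

Let measurable_tail k : measurable_fun setT (tail k).
Proof.
apply: (measurable_fun_fubini_tonelli_F (m2 := unif R)
  (fun z : T * measurableTypeR R => (enorm (Xlim z.1 z.2 - X k z.1 z.2))%:E)).
- exact: measurable_dist.
- by move=> z; rewrite lee_fin enorm_ge0.
Qed.

Let integral_tail k : (\int[mu]_y tail k y <= (m.+1%:R * (4 * 2^-1 ^+ k))%:E)%E.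
Proof.
apply: (@le_trans _ _ (\int[mu]_y (m.+1%:R%:E * \sum_(j <oo) D (j + k)%N y))%E).
  apply: ge0_le_integral => //.
  - by move=> y _; apply: integral_ge0 => s _; rewrite lee_fin enorm_ge0.
  - by apply: measurable_funeM; exact: ge0_emeasurable_sum.
rewrite ge0_integralZl//; last 2 first.
- exact: ge0_emeasurable_sum.
- by move=> y _; exact: nneseries_ge0.
rewrite EFinM; apply: lee_wpmul2l; first by rewrite lee_fin.
rewrite integral_nneseries; last 3 first.
- exact: measurableT.
- by move=> j; exact: measurable_D.
- by move=> j y _; exact: D0.
rewrite (_ : 4 = 2 * 2 :> R); last by ring.
apply: (@nneseries_geometric_le R 2 k (fun j => \int[mu]_y D j y)%E) => // j.
exact: integral_ge0.
Qed.

(** At a fixed level [lv J] the distance is at most the quantization error of the empirical measure,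
    plus the mean distance from [Xlim] to [X J], plus the mismatch of the masses weighted by the
    norms of the centers. The first two are small in mean uniformly in [N]; the last tends to [0] as
    [N] grows. *)
Lemma limit_measure : exists W : T -> probability V R,
  forall (s : regular_summation R) (sigma : nat -> nat), subsequence sigma ->
  let w N y := wasserstein1 (empirical s N (fun n => u (sigma n) y)) (W y) in
  (forall N, measurable_fun setT (w N)) /\
  (\int[mu]_y w N y @[N --> \oo] --> 0)%E.
Proof.
have /choice[W WP] y := probability_pushforward (unif R) (measurable_Xlim y).
exists W => s sigma sS w; have mw N : measurable_fun setT (w N).
  apply: wasserstein1_measurable.
  - move=> y; rewrite integral_empirical; last 2 first.
    + exact: measurable_enorm_id.
    + by move=> z; rewrite lee_fin enorm_ge0.
    under eq_bigr do rewrite -EFinM.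
    by rewrite sumEFin ltry.
  - by move=> h mh h0; exact: (measurable_emp s N sigma mh h0).
  move=> h mh h0; rewrite (_ : (fun y => _) = (fun y => \int[unif R]_s h (Xlim y s))%E).
    apply: (measurable_fun_fubini_tonelli_F (m2 := unif R)
      (fun z : T * measurableTypeR R => h (Xlim z.1 z.2))) => //.
    exact: measurableT_comp.
  by apply/funext => y; rewrite (WP y).2.
split => //.
have w0 N y : (0 <= w N y)%E.
  by apply: le_ereal_inf_tmp => _ [g _ <-]; apply: integral_ge0 => z _; rewrite lee_fin enorm_ge0.
have I0 N : (0 <= \int[mu]_y w N y)%E by apply: integral_ge0 => y _.
suff wle (e : R) : 0 < e -> \forall N \near \oo, (\int[mu]_y w N y <= e%:E)%E.
  apply/fine_cvgP; split.
    near=> N; rewrite ge0_fin_numE ?I0//.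
    apply: (@le_lt_trans _ _ 1%E); last exact: ltry.
    by near: N; exact: wle.
  apply/cvgrPdist_le => e e0; near=> N.
  rewrite sub0r normrN ger0_norm; last by rewrite fine_ge0 ?I0.
  have we : (\int[mu]_y w N y <= e%:E)%E by near: N; exact: wle.
  by rewrite -lee_fin fineK// ge0_fin_numE ?I0// (le_lt_trans we)// ltry.
move=> e0.
(* The two terms are the bounds of [lvP] and [integral_tail]. The level is chosen before [N], so
   that the number of cells and the norms of their centers stay fixed. *)
have [J JP] : exists J, 2^-1 ^+ J + m.+1%:R * (4 * 2^-1 ^+ J) <= e / 2 :> R.
  pose c : R := (1 + m.+1%:R * 4) / (e / 2).
  exists (Num.trunc c).+1; rewrite mulrA -[X in X + _]mul1r -mulrDl exprVn ler_pdivrMr ?exprn_gt0//.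
  rewrite [leRHS]mulrC -ler_pdivrMr ?divr_gt0// (le_trans (ltW (truncnS_gt c)))//.
  by rewrite -natrX ler_nat ltnW// ltn_expl.
pose M := (2 ^ lv J)%N; pose B := \sum_(i < M) enorm (center (lv J) i : V).
have B0 : 0 <= B by apply: sumr_ge0 => i _; exact: enorm_ge0.
have e1 : 0 < e / 2 / (B + 1) by rewrite !divr_gt0// ltr_wpDl.
near=> N.
pose c i := enorm (center (lv J) i : V).
have c0 i : 0 <= c i by exact: enorm_ge0.
apply: (@le_trans _ _ (\int[mu]_y ((\int[emp s N sigma y]_x (enorm (x - quant (lv J) x))%:E +
   tail J y) + \sum_(i < M) (c i)%:E * `|p s N sigma (lv J) i y - q (lv J) i y|%:E))%E).
  apply: ge0_le_integral => //.
  - apply: emeasurable_funD; first apply: emeasurable_funD => //.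
      apply: measurable_emp => [|z]; first exact: measurable_quant_dist.
      by rewrite lee_fin enorm_ge0.
    apply: emeasurable_sum => i; exact: measurable_funeM.
  move=> y _.
  apply: le_trans (@wasserstein1_le_same_cells R m _ _ V (measurableTypeR R)
    (emp s N sigma y) (unif R) id (Xlim y) _ (W y) M (cell (lv J)) (idx (lv J) y)
    (center (lv J)) _ _ _ _ _ _ _ _) _ => //.
  - by move=> A _; rewrite (WP y).1.
  - exact: measurable_cell.
  - by move=> z; exact: cell_lt.
  apply: leeD => //; rewrite -sumEFin; apply: lee_sum => i _.
  by rewrite idx_mass// EFinM muleC.
have me : measurable_fun setT (fun y => \int[emp s N sigma y]_x (enorm (x - quant (lv J) x))%:E)%E.
  by apply: measurable_emp => [|z]; [exact: measurable_quant_dist|rewrite lee_fin enorm_ge0].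
have tail0 y : (0 <= tail J y)%E by apply: integral_ge0 => z _; rewrite lee_fin enorm_ge0.
have em0 y : (0 <= \int[emp s N sigma y]_x (enorm (x - quant (lv J) x))%:E)%E.
  by apply: integral_ge0 => z _; rewrite lee_fin enorm_ge0.
rewrite ge0_integralD//; last 4 first.
- by move=> y _; exact: adde_ge0.
- exact: emeasurable_funD.
- by move=> y _; apply: sume_ge0 => i _; rewrite mule_ge0 ?lee_fin.
- by apply: emeasurable_sum => i; exact: measurable_funeM.
rewrite ge0_integralD//.
rewrite [in leRHS](splitr e) EFinD; apply: leeD.
  apply: (@le_trans _ _ ((2^-1 ^+ J)%:E + (m.+1%:R * (4 * 2^-1 ^+ J))%:E)%E); last first.
    by rewrite -EFinD lee_fin.
  apply: leeD => //; apply: integral_emp_le; [exact: measurable_quant_dist| |exact: lvP].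
  by move=> z; rewrite lee_fin enorm_ge0.
rewrite ge0_integral_sum//; last 2 first.
- by move=> i; exact: measurable_funeM.
- by move=> i y _; rewrite mule_ge0 ?lee_fin.
apply: (@le_trans _ _ (\sum_(i < M) (c i)%:E * (e / 2 / (B + 1))%:E)%E).
  apply: lee_sum => i _; rewrite ge0_integralZl//; last by rewrite lee_fin.
  apply: lee_wpmul2l; first by rewrite lee_fin.
  have : forall i : 'I_M,
      (\int[mu]_y `|p s N sigma (lv J) i y - q (lv J) i y|%:E <= (e / 2 / (B + 1))%:E)%E.
    near: N; apply: filter_forall => j; exact: cells_cvg.
  exact.
rewrite (eq_bigr (fun i : 'I_M => (c i * (e / 2 / (B + 1)))%:E))//.
rewrite sumEFin lee_fin -mulr_suml -/B mulrCA ler_piMr ?divr_ge0 ?(ltW e0)//.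
by rewrite ler_pdivrMr ?mul1r ?lerDl// ltr_wpDl.
Unshelve. all: by end_near. Qed.

End limit_measure.

(** * Lebesgue measure and uniform integrability *)

Section lebesgue_sets.
Context (R : realType) (D : nat).
Local Notation E := 'rV[R]_D.+1.
Local Notation space := (lebesgue_space R D).

Let prod_other (ab : E * E) (i : 'I_D.+1) : R :=
  \prod_(j < D.+1 | j != i) Num.max 0 (ab.2 ord0 j - ab.1 ord0 j).

Let prod_other_ge0 ab i : 0 <= prod_other ab i.
Proof. by apply: prodr_ge0 => j _; rewrite le_max lexx. Qed.

Let box_volumeE ab i :
  box_volume ab = Num.max 0 (ab.2 ord0 i - ab.1 ord0 i) * prod_other ab i.
Proof. by rewrite /box_volume (bigD1 i). Qed.

Let box_volume_ge0 (ab : E * E) : 0 <= box_volume ab.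
Proof. by apply: prodr_ge0 => i _; rewrite le_max lexx. Qed.

Let setc (x : E) i (t : R) : E := \row_j if j == i then t else x ord0 j.

Let setcE x i t : setc x i t ord0 i = t.
Proof. by rewrite mxE eqxx. Qed.

Let setcN x i t j : j != i -> setc x i t ord0 j = x ord0 j.
Proof. by rewrite mxE => /negPf ->. Qed.

(* A box is cut by the hyperplane [x_i = a] into two boxes that overlap by a
   slab of width [e], since the pieces of a cover have to be open. *)
Let cut_volume (ab : E * E) i (a e : R) : 0 <= e ->
  box_volume (ab.1, setc ab.2 i (Num.min (ab.2 ord0 i) a)) +
  box_volume (setc ab.1 i (Num.max (ab.1 ord0 i) (a - e)), ab.2) <=
  box_volume ab + e * prod_other ab i.
Proof.
move=> e0; rewrite !(box_volumeE _ i)/= !setcE.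
have -> : prod_other (ab.1, setc ab.2 i (Num.min (ab.2 ord0 i) a)) i = prod_other ab i.
  by apply: eq_bigr => j ji /=; rewrite setcN.
have -> : prod_other (setc ab.1 i (Num.max (ab.1 ord0 i) (a - e)), ab.2) i = prod_other ab i.
  by apply: eq_bigr => j ji /=; rewrite setcN.
rewrite -!mulrDl ler_wpM2r//; move: (ab.1 ord0 i) (ab.2 ord0 i) => x y.
rewrite /Num.max /Num.min; repeat case: ltP => ?; lra.
Qed.

(** Caratheodory's criterion: every cover of [A] by boxes is cut into covers of the two parts of
    [A], at an arbitrarily small cost in volume. *)
Lemma halfspace_measurable i (a : R) : measurable ([set x | x ord0 i < a] : set space).
Proof.
set H : set E := [set x | x ord0 i < a].
apply: le_caratheodory_measurable => A; apply: le_ereal_inf_tmp => _ [B AB <-].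
apply/lee_addgt0Pr => e e0.
(* The overlap adds at most [e / 2 ^ (k+1)] to the volume of box [k], hence [e] in total. *)
pose del k : R := e / (2 ^ k.+1)%:R / (prod_other (B k) i + 1).
have P1 k : 0 < prod_other (B k) i + 1 by rewrite ltr_wpDl.
have del0 k : 0 < del k by rewrite !divr_gt0.
pose B1 k := ((B k).1, setc (B k).2 i (Num.min ((B k).2 ord0 i) a)).
pose B2 k := (setc (B k).1 i (Num.max ((B k).1 ord0 i) (a - del k)), (B k).2).
have v0 (C : nat -> E * E) k : (0 <= (box_volume (C k))%:E)%E by rewrite lee_fin.
apply: (@le_trans _ _ (\sum_(k <oo) (box_volume (B1 k))%:E +
    \sum_(k <oo) (box_volume (B2 k))%:E)%E).
  apply: leeD; apply: ereal_inf_lbound.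
    exists B1 => // x [Ax Hx]; have [k _ Bk] := AB _ Ax; exists k => // j /=.
    have /andP[h1 h2] := Bk j; rewrite h1/=; have [ji|ji] := eqVneq j i.
      by move: h2; rewrite ji => h2; rewrite setcE lt_min h2.
    by rewrite setcN.
  exists B2 => // x [Ax Hx]; have [k _ Bk] := AB _ Ax; exists k => // j /=.
  have /andP[h1 h2] := Bk j; rewrite h2 andbT; have [ji|ji] := eqVneq j i.
    move: h1; rewrite ji => h1; rewrite setcE gt_max h1/= ltrBlDr ltr_pwDr//.
    by rewrite leNgt; apply/negP.
  by rewrite setcN.
rewrite -nneseriesD//; try by move=> k *.
apply: (@le_trans _ _ (\sum_(k <oo) ((box_volume (B k))%:E + (e / (2 ^ k.+1)%:R)%:E))%E).
  apply: lee_nneseries => [k _|k _]; first by rewrite adde_ge0.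
  rewrite -!EFinD lee_fin (le_trans (cut_volume _ _ _ (ltW (del0 k))))// lerD2l.
  by rewrite /del mulrAC ler_pdivrMr// ler_wpM2l ?divr_ge0 ?lerDl// ltW.
by apply: epsilon_trick => //; exact: ltW.
Qed.

(** The identity from the Lebesgue space to the Borel space is measurable because its coordinates
    are, by the half-spaces. *)
Lemma open_lebesgue_measurable (O : set E) : open O -> measurable (O : set space).
Proof.
move=> oO; have mi : measurable_fun [set: space] (id : space -> E).
  apply: measurable_fun_rV => i.
  apply: (measurability _ (RGenInftyO.measurableE R)) => _ [_ [a ->] <-].
  rewrite setTI (_ : _ @^-1` _ = [set x : space | x ord0 i < a]).
    exact: halfspace_measurable.
  by apply/seteqP; split => x /=; rewrite in_itv.
by have := mi measurableT O (open_rV_measurable oO); rewrite setTI.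
Qed.

Lemma lebesgue_box_le (ab : E * E) (A : set space) :
  A `<=` box ab -> (lebesgue A <= (box_volume ab)%:E)%E.
Proof.
move=> Aab; apply: ereal_inf_lbound => /=.
pose B (k : nat) : E * E := if k is 0 then ab else (0, 0).
exists B.
  by move=> x /Aab xab; exists 0%N.
rewrite nneseries_recl//; last by move=> k _; rewrite lee_fin.
rewrite eseries0 ?adde0// => -[//|k] _ _; rewrite /B.
by rewrite (box_volumeE _ ord0)/= !mxE subrr maxxx mul0r.
Qed.

Lemma bounded_coord (Q : set E) : bounded_set Q ->
  exists2 M : R, 0 < M & forall x, Q x -> forall i, - M < x ord0 i < M.
Proof.
move=> /pinfty_ex_gt0[M _ MQ]; exists (`|M| + 1); first by rewrite ltr_wpDl.
move=> x /MQ /= xM i; rewrite -ltr_norml ltr_pwDr//.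
apply: le_trans (le_trans xM (ler_norm M)).
rewrite -[leRHS]/(mx_norm x) mx_normrE.
exact: (le_bigmax _ (fun ij : 'I_1 * 'I_D.+1 => `|x ij.1 ij.2|) (ord0, i)).
Qed.

Lemma bounded_lebesgue_lty (Q : set E) :
  bounded_set Q -> (lebesgue (Q : set space) < +oo)%E.
Proof.
move=> /bounded_coord[M M0 QM].
apply: le_lt_trans (@lebesgue_box_le (const_mx (- M), const_mx M) Q _) _; last exact: ltry.
by move=> x /QM Qx i; rewrite !mxE.
Qed.

End lebesgue_sets.

Section uniform_integrability.
Context (R : realType) (D m : nat).
Local Notation space := (lebesgue_space R D).
Variables (Q : set space) (U : nat -> space -> 'rV[R]_m.+1).
Hypothesis domQ : bounded_domain (Q : set 'rV[R]_D.+1).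
Hypothesis L1U : forall n, L1 Q (U n).
Hypothesis equiU : equi_integrable Q U.

Lemma domain_measurable : measurable Q.
Proof. by case: domQ => _ oQ _ _; exact: open_lebesgue_measurable. Qed.

Let mQ := domain_measurable.

Lemma domain_lty : (lebesgue Q < +oo)%E.
Proof. by case: domQ => _ _ _ bQ; exact: bounded_lebesgue_lty. Qed.

Let mUQ n : measurable_fun Q (fun y => (enorm (U n y))%:E).
Proof.
apply/measurable_EFinP.
have [mU _] := L1U n.
exact: (measurableT_comp (measurable_enorm (@measurable_id _ _ setT)) mU).
Qed.

Let U0 n y : (0 <= (enorm (U n y))%:E)%E.
Proof. by rewrite lee_fin enorm_ge0. Qed.

(* Slabs of small width have small measure, and finitely many of them cover [Q]:
   this turns equi-integrability into boundedness in [L^1]. *)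
Lemma slice_small (d : R) : 0 < d -> exists (M h : R) (K : nat),
  [/\ 0 < h, forall x : 'rV[R]_D.+1, Q x -> - M < x ord0 ord0,
     forall x : 'rV[R]_D.+1, Q x -> x ord0 ord0 < - M + K%:R * h &
     forall t : R, (lebesgue
       (Q `&` [set x : 'rV[R]_D.+1 | (t <= x ord0 ord0 < t + h)%R]) < d%:E)%E].
Proof.
move=> d0; case: domQ => _ _ _ /bounded_coord[M M0 QM].
pose P : R := \prod_(j < D.+1 | j != ord0) (2 * M).
have P0 : 0 <= P by apply: prodr_ge0 => j _; rewrite mulr_ge0// ltW.
(* The slab will be enclosed in a box of volume [2 * h * P], at most [2 * d / 3]. *)
pose h := d / 3 / (P + 1).
have h0 : 0 < h by rewrite !divr_gt0// ltr_wpDl.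
exists M, h, (Num.trunc (2 * M / h)).+1; split => //.
- by move=> x /QM/(_ ord0)/andP[].
- move=> x /QM/(_ ord0)/andP[_ xM]; apply: (lt_trans xM).
  rewrite addrC -ltrBlDr opprK -ltr_pdivrMr// (_ : M + M = 2 * M); last by ring.
  exact: truncnS_gt.
move=> t.
(* Boxes are open while the slab contains its face at [t], so the box starts at [t - h]. *)
pose a : 'rV[R]_D.+1 := \row_j if j == ord0 then t - h else - M.
pose b : 'rV[R]_D.+1 := \row_j if j == ord0 then t + h else M.
apply: (@le_lt_trans _ _ (box_volume (a, b))%:E).
  apply: lebesgue_box_le => x [Qx /= /andP[tx xt]] j; rewrite !mxE.
  case: eqP => [->|_]; last exact: QM.
  by rewrite xt andbT (lt_le_trans _ tx)// gtrBl.
rewrite lte_fin /box_volume (bigD1 ord0)//= !mxE eqxx.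
rewrite (eq_bigr (fun=> 2 * M)); last first.
  move=> j /negPf j0; rewrite !mxE j0 opprK (_ : M + M = 2 * M); last by ring.
  by apply/max_idPr; rewrite mulr_ge0// ltW.
rewrite -/P (_ : t + h - (t - h) = 2 * h); last by ring.
rewrite (max_idPr _); last by rewrite mulr_ge0// ltW.
have hP : h * (P + 1) = d / 3 by rewrite /h divfK// gt_eqF// ltr_wpDl.
have : h * P <= d / 3 by rewrite -hP ler_wpM2l ?lerDl// ltW.
rewrite -mulrA; lra.
Qed.

Lemma L1_bound : exists2 B : R, 0 <= B &
  forall n, (\int[lebesgue]_(y in Q) (enorm (U n y))%:E <= B%:E)%E.
Proof.
have [d d0 dU] := equiU ltr01.
have [M [h [K [h0 QM QK small]]]] := slice_small d0.
exists K%:R => // n.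
(* The part of [Q] in the first [k] slabs; each slab adds at most [1] to the integral, for every
   [n]. *)
pose A k : set space := Q `&` [set x : 'rV[R]_D.+1 | x ord0 ord0 < - M + k%:R * h].
have mA k : measurable (A k).
  by apply: measurableI => //; exact: halfspace_measurable.
have -> : Q = A K by apply/seteqP; split => x; [move=> Qx; split => //; exact: QK|case].
elim: K {QK} => [|k IH].
  rewrite (_ : A 0%N = set0) ?integral_set0//; apply/seteqP; split => // x [Qx /=].
  by rewrite mul0r addr0 ltNge (ltW (QM _ Qx)).
pose S : set space := Q `&`
    [set x : 'rV[R]_D.+1 | - M + k%:R * h <= x ord0 ord0 < - M + k%:R * h + h].
have mS : measurable S.
  rewrite (_ : S = A k.+1 `\` A k); first exact: measurableD.
  rewrite /S /A -natr1 mulrDl mul1r addrA; apply/seteqP; split => x /=.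
    by move=> [Qx /andP[h1 h2]]; split => // -[_]; rewrite ltNge h1.
  move=> [[Qx h1] h2]; split => //; rewrite h1 andbT leNgt; apply/negP => h3.
  exact: h2.
have -> : A k.+1 = A k `|` S.
  rewrite /A /S -natr1 mulrDl mul1r addrA; apply/seteqP; split => x /=.
    move=> [Qx xk]; have [xk1|xk1] := ltP (x ord0 ord0) (- M + k%:R * h); [by left|right].
    by rewrite xk.
  move=> [[Qx xk]|[Qx /andP[_ xk]]]; split => //.
  by rewrite (lt_trans xk)// ltrDl.
rewrite ge0_integral_setU//; last 2 first.
- by apply: measurable_funS (mUQ n) => // x [[]|[]].
- rewrite disj_set2E; apply/eqP/seteqP; split => // x [[_ /= h1] [_ /andP[h2 _]]].
  by move: h1; rewrite ltNge h2.
rewrite -natr1 EFinD; apply: leeD => //; apply/ltW/dU => //; last exact: small.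
by move=> x [].
Qed.

(** By Markov's inequality and the [L^1] bound, the sets where the norm exceeds a large [c] have
    measure below the [d] of equi-integrability, for all [n] at once. *)
Lemma uniform_integrability (e : R) : 0 < e -> exists2 c : R, 1 <= c &
  forall n : nat, measurable (Q `&` [set y | c < enorm (U n y)]) /\
  (\int[lebesgue]_(y in Q `&` [set y | (c < enorm (U n y))%R]) (enorm (U n y))%:E <= e%:E)%E.
Proof.
move=> e0; have [d d0 dU] := equiU e0; have [B B0 BU] := L1_bound.
(* Then [c * d > B]. The last summand ensures [c >= 1], by which [2 * enorm x + 1 <= 3 * enorm x]
   wherever the norm exceeds [c]. *)
pose c := (B + 1) / d + 1.
have c1 : 1 <= c by rewrite lerDr divr_ge0 ?addr_ge0// ltW.
have c0 : 0 < c by rewrite (lt_le_trans ltr01).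
exists c => // n; set S := Q `&` _.
have mS : measurable S.
  have := emeasurable_fun_o_infty mQ (mUQ n) c%:E.
  by congr (measurable (_ `&` _)); apply/seteqP; split => y /=; rewrite lte_fin.
split => //; apply/ltW/dU => //; first by move=> y [].
have cS : (c%:E * lebesgue S <= B%:E)%E.
  rewrite -integral_cst//; apply: le_trans (BU n).
  apply: (@le_trans _ _ (\int[lebesgue]_(y in S) (enorm (U n y))%:E)%E).
    apply: ge0_le_integral => //.
    - by move=> y _; rewrite lee_fin ltW.
    - by apply: measurable_funS (mUQ n) => // y [].
    by move=> y [_ /= cy]; rewrite lee_fin ltW.
  by apply: ge0_subset_integral => // y [].
have Sfin : lebesgue S \is a fin_num.
  rewrite ge0_fin_numE// (le_lt_trans _ domain_lty)// le_measure ?inE//.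
  by move=> y [].
move: cS; rewrite -(fineK Sfin) -EFinM lee_fin lte_fin => cS.
rewrite -(ltr_pM2l c0) (le_lt_trans cS)// /c mulrDl mul1r divfK ?gt_eqF//.
lra.
Qed.

End uniform_integrability.

(** Passes between integrals over [Q] and a finite measure on the whole space, for which the
    averaging argument is stated. *)
Lemma ge0_integral_mfrestr d (T : measurableType d) (R : realType)
    (mu : {measure set T -> \bar R}) (Q : set T) (mQ : measurable Q)
    (Qoo : (mu Q < +oo)%E) (f : T -> \bar R) :
  measurable_fun setT f -> (forall y, 0 <= f y)%E ->
  (\int[mfrestr mQ Qoo]_y f y = \int[mu]_(y in Q) f y)%E.
Proof.
move=> mf f0; rewrite (@ge0_negligible_integral _ _ _ (mfrestr mQ Qoo) _ (~` Q))//.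
- rewrite setTD setCK; apply: eq_measure_integral => A mA AQ.
  by rewrite /= /mfrestr /mrestr setIidl.
- exact: measurableC.
- by rewrite /= /mfrestr /mrestr setICl measure0.
Qed.

(** Where the norm exceeds [c] the error is at most three times the norm, hence the [e / 6];
    elsewhere it is uniformly small once the cells are fine, and [Q] has finite measure. *)
Lemma quant_uniform (R : realType) (D m : nat) (Q : set (lebesgue_space R D))
    (U : nat -> lebesgue_space R D -> 'rV[R]_m.+1) (e : R) :
  bounded_domain (Q : set 'rV[R]_D.+1) -> (forall n, L1 Q (U n)) ->
  equi_integrable Q U -> 0 < e -> exists L0, forall L, (L0 <= L)%N ->
  forall n, (\int[lebesgue]_(y in Q) (enorm (U n y - quant L (U n y)))%:E <= e%:E)%E.
Proof.
move=> domQ L1U equiU e0; have mQ := domain_measurable domQ.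
have Qoo := domain_lty domQ; set q := fine (lebesgue Q).
have qE : lebesgue Q = q%:E by rewrite fineK// ge0_fin_numE.
have q0 : 0 <= q by exact: fine_ge0.
have e6 : 0 < e / 6 by rewrite divr_gt0.
have [c c1 cU] := uniform_integrability domQ L1U equiU e6.
have del0 : 0 < e / 2 / (q + 1) by rewrite !divr_gt0// ltr_wpDl.
have [L0 L0P] := dist_quant_small m c del0.
exists L0 => L LL0 n; have [mS US] := cU n; set S := Q `&` _ in mS US.
have mU : measurable_fun Q (fun y => (enorm (U n y))%:E).
  have [mU _] := L1U n; apply/measurable_EFinP.
  exact: (measurableT_comp (measurable_enorm (@measurable_id _ _ setT)) mU).
have md : measurable_fun Q (fun y => (enorm (U n y - quant L (U n y)))%:E).
  have [mU' _] := L1U n.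
  exact: (measurableT_comp (measurable_quant_dist L) mU').
have mQS : measurable (Q `\` S) by exact: measurableD.
have E : Q = S `|` (Q `\` S) by rewrite setDUK// => y [].
rewrite {1}E ge0_integral_setU//; first last.
- by rewrite disj_set2E setDIK.
- by move=> y _; rewrite lee_fin enorm_ge0.
- by rewrite -E.
rewrite (splitr e) EFinD; apply: leeD.
  apply: (@le_trans _ _ (\int[lebesgue]_(y in S) (3%:E * (enorm (U n y))%:E))%E).
    apply: ge0_le_integral => //.
    - by move=> y _; rewrite lee_fin enorm_ge0.
    - by apply: measurable_funS md => // y [].
    - by apply: measurable_funeM; apply: measurable_funS mU => // y [].
    move=> y [_ /= cy]; rewrite -EFinM lee_fin.
    by have := dist_quant_le L (U n y); have := enorm_ge0 (U n y); lra.
  rewrite ge0_integralZl_EFin//; last 2 first.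
  - by move=> y _; rewrite lee_fin enorm_ge0.
  - by apply: measurable_funS mU => // y [].
  apply: (@le_trans _ _ (3%:E * (e / 6)%:E)%E); first exact: lee_wpmul2l.
  by rewrite -EFinM lee_fin; lra.
apply: (@le_trans _ _ (\int[lebesgue]_(y in Q `\` S) (e / 2 / (q + 1))%:E)%E).
  apply: ge0_le_integral => //.
  - by move=> y _; rewrite lee_fin enorm_ge0.
  - by apply: measurable_funS md => // y [].
  move=> y [Qy nS]; rewrite lee_fin; apply: L0P => //; rewrite leNgt.
  by apply/negP => cy; apply: nS.
rewrite integral_cst//; apply: (@le_trans _ _ ((e / 2 / (q + 1))%:E * q%:E)%E).
  apply: lee_wpmul2l; first by rewrite lee_fin ltW.
  by rewrite -qE le_measure ?inE// => y [].
rewrite -EFinM lee_fin -(mulrA (e / 2)) ler_piMr ?divr_ge0 ?(ltW e0)//.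
by rewrite mulrC ler_pdivrMr ?mul1r ?lerDl// ltr_wpDl.
Qed.

(** * Exact properties of the limit masses and conclusion *)

Section cesaro_monotone.
Context d (T : measurableType d) (R : realType).

Lemma le_cesaro (F F' : nat -> set T) k y : (forall n, F n `<=` F' n) ->
  cesaro R F k y <= cesaro R F' k y :> R.
Proof.
move=> FF'; apply: ler_sum => i _; rewrite ler_wpM2l ?exprn_ge0//.
rewrite !indicE; have [/set_mem/FF'/mem_set -> //|_] := boolP (y \in F i).
by case: (_ \in _).
Qed.

Lemma cesaro_set0 (F : nat -> set T) k y : (forall n, F n = set0) ->
  cesaro R F k y = 0 :> R.
Proof. by move=> F0; apply: big1 => i _; rewrite F0 indic0 mulr0. Qed.

Lemma cesaro_setT (F : nat -> set T) k y : (forall n, F n = setT) ->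
  cesaro R F k y = 1 :> R.
Proof.
move=> FT; rewrite /cesaro /comb -[RHS](sum_inv4 R k).
by apply: eq_bigr => i _; rewrite FT indicT mulr1.
Qed.

Lemma lsup_cst (c : R) : lsup (fun=> c) = c.
Proof.
apply/eqP; rewrite eq_le; have [|h1 h2] := @andP _ _ (@lsup_bounds R (fun=> c) 0%N c c _).
  by move=> n _; rewrite lexx.
by rewrite h1 h2.
Qed.

End cesaro_monotone.

Theorem proposition3p9 (R : realType) (D m : nat) (Q : set 'rV[R]_D.+1)
    (U : nat -> 'rV[R]_D.+1 -> 'rV[R]_m.+1)
    (domQ : bounded_domain Q)
    (L1U : forall n, L1 Q (U n))
    (equiU : equi_integrable Q U) :
  exists (nu : nat -> nat) (V : 'rV[R]_D.+1 -> probability 'rV[R]_m.+1 R),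
    subsequence nu /\ completely_S_convergent Q (U \o nu) V.
Proof.
pose T := lebesgue_space R D.
have mQ : measurable (Q : set T) := domain_measurable domQ.
have Qoo : (lebesgue (Q : set T) < +oo)%E := domain_lty domQ.
pose mu : {finite_measure set T -> \bar R} := mfrestr mQ Qoo.
(* The functions are only known to be measurable on [Q]; the extension by [0] is measurable on the
   whole space, and [mu] does not charge the complement of [Q]. *)
pose u n : T -> 'rV[R]_m.+1 := fun y => if y \in Q then U n y else 0.
have uE n y : Q y -> u n y = U n y by move=> Qy; rewrite /u mem_set.
have mu_ n : measurable_fun setT (u n).
  move=> _ A mA; rewrite setTI.
  have [mU _] := L1U n; have mUA := mU mQ A mA.
  have [A0|A0] := pselect (A 0).
    rewrite (_ : _ @^-1` _ = (Q `&` U n @^-1` A) `|` ~` Q).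
      by apply: measurableU => //; exact: measurableC.
    apply/seteqP; split => y /=; rewrite /u.
      by case: ifPn => [/set_mem|/negP yQ]; [left|right => Qy; apply/yQ/mem_set].
    by move=> [[Qy Uy]|Qy]; [rewrite mem_set|rewrite memNset].
  rewrite (_ : _ @^-1` _ = Q `&` U n @^-1` A)//.
  apply/seteqP; split => y /=; rewrite /u; first by case: ifPn => [/set_mem|].
  by move=> [Qy Uy]; rewrite mem_set.
have quantu (e : R) : 0 < e -> exists L0, forall L, (L0 <= L)%N ->
    forall n, (\int[mu]_y (enorm (u n y - quant L (u n y)))%:E <= e%:E)%E.
  move=> e0; have [L0 L0P] := quant_uniform domQ L1U equiU e0.
  exists L0 => L LL0 n; rewrite ge0_integral_mfrestr; last 2 first.
  - exact: (measurableT_comp (measurable_quant_dist L) (mu_ n)).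
  - by move=> y; rewrite lee_fin enorm_ge0.
  apply: le_trans (L0P L LL0 n); rewrite le_eqVlt; apply/orP; left; apply/eqP.
  by apply: eq_integral => y /set_mem Qy; rewrite uE.
pose E (Li : nat * nat) (n : nat) : set T := [set y | (cell Li.1 (u n y) < Li.2)%N].
have mE Li n : measurable (E Li n).
  by have := mu_ n measurableT _ (measurable_cell_lt Li.1 Li.2); rewrite setTI.
have [nu [G [nuS mG GE Gcvg]]] := extraction mu mE.
have := @limit_measure _ T R m mu (u \o nu) (fun L i => G (L, i)).
case.
- by move=> n; exact: mu_.
- by move=> L i; exact: mG.
(* Here and in the next three points the relation holds at every [y]: [GE] gives [G] by Cesaro means
   of the sets, for which it holds exactly. *)
- move=> L y; rewrite GE -[RHS]lsup_cst; congr lsup; apply/funext => k.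
  apply: cesaro_set0 => n; apply/seteqP; split => // z.
- move=> L y; rewrite GE -[RHS]lsup_cst; congr lsup; apply/funext => k.
  by apply: cesaro_setT => n; apply/seteqP; split => // z _ /=; exact: cell_lt.
- move=> L y i j ij; rewrite !GE; apply: le_lsup => k; [exact: cesaro_bounds|exact: cesaro_bounds|].
  by apply: le_cesaro => n z /= zi; exact: leq_trans zi ij.
- move=> L L' i y LL'; rewrite !GE; congr lsup; apply/funext => k; congr (cesaro R _ k y).
  apply/funext => n; rewrite /E /=; apply/seteqP; split => z /=;
    by rewrite (cell_div _ LL') ltn_divLR// expn_gt0.
- by move=> L i s sigma sS e e0; exact: (Gcvg (L, i)).
- by move=> e e0; have [L0 L0P] := quantu e e0; exists L0 => L LL0 n; exact: L0P.
move=> W WP; exists nu, W; split; first exact: nuS.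
move=> s sigma sS.
have [mw wcvg] := WP s sigma sS.
have wE N y : Q y -> wasserstein1 (empirical s N (((U \o nu) \o sigma)^~ y)) (W y) =
    wasserstein1 (empirical s N (fun n => (u \o nu) (sigma n) y)) (W y).
  by move=> Qy; congr (wasserstein1 (empirical _ _ _) _); apply/funext => n /=; rewrite uE.
split => [N|].
  apply: (eq_measurable_fun (fun y =>
    wasserstein1 (empirical s N (fun n => (u \o nu) (sigma n) y)) (W y))).
    by move=> y /set_mem Qy; rewrite wE.
  exact: measurable_funTS (mw N).
apply: cvg_trans wcvg; apply: near_eq_cvg; near=> N.
rewrite ge0_integral_mfrestr//.
  by apply: eq_integral => y /set_mem Qy; rewrite wE.
move=> y; apply: le_ereal_inf_tmp => _ [g _ <-].
by apply: integral_ge0 => z _; rewrite lee_fin enorm_ge0.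
Unshelve. all: by end_near. Qed.
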